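(* For every $d\in\mathbb N$ and every $1\le q\le\infty$ there exists a constant $C(d,q)$, depending only on $d$ and $q$, such that for every $n\in\mathbb N$ there is a set $\Xi_m=\{\xi^\nu\}_{\nu=1}^m\subset\mathbb T^d$ with $m\le C(d,q)2^n$ that provides universal discretization in $L_q$ for the collection $\mathcal C(n,d)$.
   Context: $\mathbb T^d:=[0,2\pi)^d$ with the normalized Lebesgue measure, so $\|f\|_q:=\big((2\pi)^{-d}\int_{\mathbb T^d}|f(\mathbf x)|^q\,d\mathbf x\big)^{1/q}$ for $1\le q<\infty$, and $\|f\|_\infty:=\sup_{\mathbf x}|f(\mathbf x)|$ (for continuous $f$). For a finite $Q\subset\mathbb Z^d$, $\mathcal T(Q):=\{f=\sum_{\mathbf k\in Q}c_{\mathbf k}e^{i(\mathbf k,\mathbf x)}:\ c_{\mathbf k}\in\mathbb C\}$. For $\mathbf s\in\mathbb Z_+^d$ let $R(\mathbf s):=\{\mathbf k\in\mathbb Z^d:|k_j|<2^{s_j},\ j=1,\dots,d\}$, and let $\mathcal C(n,d):=\{\mathcal T(R(\mathbf s)):\ \mathbf s\in\mathbb Z_+^d,\ \|\mathbf s\|_1=n\}$. A set $\{\xi^\nu\}_{\nu=1}^m\subset\mathbb T^d$ provides universal discretization in $L_q$ for a collection of subspaces $\{X^j\}_{j=1}^k$ if: for $1\le q<\infty$ there are positive constants $C_1(d,q),C_2(d,q)$ (independent of $j$, $n$) such that for every $j$ and every $f\in X^j$, $C_1(d,q)\|f\|_q^q\le \frac1m\sum_{\nu=1}^m|f(\xi^\nu)|^q\le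 C_2(d,q)\|f\|_q^q$; for $q=\infty$ there is a positive constant $C_1(d)$ such that for every $j$ and every $f\in X^j$, $C_1(d)\|f\|_\infty\le\max_{1\le\nu\le m}|f(\xi^\nu)|\le\|f\|_\infty$. *)

(* Defs.v *)
From Stdlib Require Import Reals Lra Lia ZArith List.
Open Scope R_scope.

(** Points of T^d: functions nat -> R, only coordinates j < d matter. *)
Definition in_torus (d : nat) (x : nat -> R) : Prop :=
  forall j : nat, (j < d)%nat -> 0 <= x j < 2 * PI.

Fixpoint nsum (d : nat) (g : nat -> R) : R :=
  match d with O => 0 | S d' => nsum d' g + g d' end.

Definition dotZ (d : nat) (k : nat -> Z) (x : nat -> R) : R :=
  nsum d (fun j => IZR (k j) * x j).

Definition upd {A : Type} (k : nat -> A) (j : nat) (z : A) : nat -> A :=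
  fun i => if Nat.eqb i j then z else k i.

(** sum over integers z with |z| < M (M >= 1), i.e. z = -(M-1), ..., M-1 *)
Definition zsum (M : nat) (G : Z -> R) : R :=
  sum_f_R0 (fun t => G (Z.of_nat t - (Z.of_nat M - 1))%Z) (2 * M - 2).

(** Sum of F k over k in R(s) = {k : |k_j| < 2^{s_j}, j < d}
    (coordinates k_j with j >= d are set to 0). *)
Fixpoint box_sum (d : nat) (s : nat -> nat) (F : (nat -> Z) -> R) : R :=
  match d with
  | O => F (fun _ => 0%Z)
  | S d' => box_sum d' s (fun k => zsum (2 ^ s d') (fun z => F (upd k d' z)))
  end.

(** A trigonometric polynomial f in T(R(s)) with coefficients
    c_k = a k + i b k; real and imaginary parts of f(x). *)
Definition tp_re (d : nat) (s : nat -> nat) (a b : (nat -> Z) -> R) (x : nat -> R) : R :=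
  box_sum d s (fun k => a k * cos (dotZ d k x) - b k * sin (dotZ d k x)).
Definition tp_im (d : nat) (s : nat -> nat) (a b : (nat -> Z) -> R) (x : nat -> R) : R :=
  box_sum d s (fun k => a k * sin (dotZ d k x) + b k * cos (dotZ d k x)).
Definition tp_abs (d : nat) (s : nat -> nat) (a b : (nat -> Z) -> R) (x : nat -> R) : R :=
  sqrt (Rsqr (tp_re d s a b x) + Rsqr (tp_im d s a b x)).

Definition norm1 (d : nat) (s : nat -> nat) : nat :=
  fold_right Nat.add 0%nat (map s (seq 0 d)).

(** |a|^q for a >= 0 and real q >= 1 (with 0^q = 0). *)
Definition rpow (a q : R) : R :=
  if Rle_dec a 0 then 0 else Rpower a q.

Fixpoint grid_sum (d N : nat) (g : (nat -> R) -> R) : R :=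
  match d with
  | O => g (fun _ => 0)
  | S d' => grid_sum d' N (fun x =>
        sum_f_R0 (fun t => g (upd x d' (2 * PI * INR t / INR N))) (N - 1))
  end.

(** Normalized integral: (2 pi)^{-d} \int_{T^d} g = lim_N N^{-d} grid_sum.
    [torus_mean d g I] says the normalized Riemann sums converge to I
    (for continuous g this limit exists and equals the normalized
    Lebesgue integral). *)
Definition torus_mean (d : nat) (g : (nat -> R) -> R) (I : R) : Prop :=
  Un_cv (fun N => grid_sum d (S N) g / INR (S N) ^ d) I.

Inductive exponent : Type := Fin (q : R) | Inf.

Definition valid_exp (q : exponent) : Prop :=
  match q with Fin q => 1 <= q | Inf => True end.

Definition univ_disc (d : nat) (q : exponent) (C1 C2 : R)
    (xi : list (nat -> R)) (n : nat) : Prop :=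
  forall (s : nat -> nat) (a b : (nat -> Z) -> R),
    norm1 d s = n ->
    match q with
    | Fin q =>
        forall I : R,
          torus_mean d (fun x => rpow (tp_abs d s a b x) q) I ->
          let D := / INR (length xi) *
                   fold_right Rplus 0 (map (fun y => rpow (tp_abs d s a b y) q) xi) in
          C1 * I <= D /\ D <= C2 * I
    | Inf =>
        let D := fold_right Rmax 0 (map (tp_abs d s a b) xi) in
        (* C1 ||f||_inf <= max_nu |f(xi^nu)| *)
        (forall x, in_torus d x -> C1 * tp_abs d s a b x <= D) /\
        (* max_nu |f(xi^nu)| <= ||f||_inf *)
        (forall B, (forall x, in_torus d x -> tp_abs d s a b x <= B) -> D <= B)
    end.

(* Main.v *)
Require Import Defs.
From Stdlib Require Import Reals ZArith List.
From Stdlib Require Import Lra Lia Permutation FunctionalExtensionality Classical.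
Open Scope R_scope.

(** The points are a Halton set in pairwise coprime bases [b_0, ..., b_(d-1)], with
    [m] of order [2^n] points.  Given [s] with [|s|_1 = n], choose [P_j = b_j^(c_j)]
    comparable to, and a large multiple of, [2^(s_j)], so that [P = P_0 ... P_(d-1) <= m].
    By the Chinese remainder theorem any [P] consecutive Halton points meet each of the
    [P] boxes with sides [2 PI / P_j] exactly once.

    It remains to see that a polynomial [f] in T(R(s)) barely oscillates on such boxes in
    the mean.  On a uniform [N]-grid, Fejer's kernel expresses each partial derivative of
    [f] as a combination of grid translates of [f] whose coefficients have absolute sum
    at most [2 * 2^(s_j)].  Hence, for [M y] the supremum of [|f|] over points within
    [2 PI / P_j] of [y], the mean value theorem bounds the oscillation of [f] near [y] by
    an average of translates of [M] with total mass at most 1/4.  Jensen's inequality and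
    translation invariance of the grid then bound the [l_q] norm of [M] by that of [f],
    so that the sum of [|f|^q] over one block of [P] Halton points is comparable to the
    grid mean, and [N] tends to infinity.  For [q = Inf] the same bound is applied to the
    constant function [M = sup |f|]. *)

(** * Finite sums over lists *)

Definition lsum {A : Type} (l : list A) (f : A -> R) : R :=
  fold_right (fun a r => f a + r) 0 l.

Lemma lsum_ext_in {A} (l : list A) f g :
  (forall a, In a l -> f a = g a) -> lsum l f = lsum l g.
Proof.
  induction l as [|a l IH]; intros H; simpl; [reflexivity|].
  rewrite (H a) by (left; reflexivity).
  rewrite IH; [reflexivity|]. intros b Hb; apply H; right; exact Hb.
Qed.

Lemma lsum_ext {A} (l : list A) f g :
  (forall a, f a = g a) -> lsum l f = lsum l g.
Proof. intros H; apply lsum_ext_in; auto. Qed.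

Lemma lsum_le {A} (l : list A) f g :
  (forall a, In a l -> f a <= g a) -> lsum l f <= lsum l g.
Proof.
  induction l as [|a l IH]; intros H; simpl; [lra|].
  apply Rplus_le_compat; [apply H; left; reflexivity|].
  apply IH; intros b Hb; apply H; right; exact Hb.
Qed.

Lemma lsum_0 {A} (l : list A) : lsum l (fun _ => 0) = 0.
Proof. induction l; simpl; lra. Qed.

Lemma lsum_nonneg {A} (l : list A) f :
  (forall a, In a l -> 0 <= f a) -> 0 <= lsum l f.
Proof. intros H; rewrite <- (lsum_0 l); apply lsum_le; exact H. Qed.

Lemma lsum_plus {A} (l : list A) f g :
  lsum l (fun a => f a + g a) = lsum l f + lsum l g.
Proof. induction l; simpl; lra. Qed.

Lemma lsum_scal {A} (l : list A) c f :
  lsum l (fun a => c * f a) = c * lsum l f.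
Proof. induction l as [|a l IH]; simpl; [lra|rewrite IH; lra]. Qed.

Lemma lsum_scal_r {A} (l : list A) c f :
  lsum l (fun a => f a * c) = lsum l f * c.
Proof. induction l as [|a l IH]; simpl; [lra|rewrite IH; lra]. Qed.

Lemma lsum_minus {A} (l : list A) f g :
  lsum l (fun a => f a - g a) = lsum l f - lsum l g.
Proof. induction l; simpl; lra. Qed.

Lemma lsum_const {A} (l : list A) c : lsum l (fun _ => c) = INR (length l) * c.
Proof.
  induction l as [|a l IH]; [simpl; lra|].
  change (lsum (a :: l) (fun _ => c)) with (c + lsum l (fun _ => c)).
  rewrite IH. change (length (a :: l)) with (S (length l)). rewrite S_INR. lra.
Qed.

Lemma lsum_app {A} (l1 l2 : list A) f :
  lsum (l1 ++ l2) f = lsum l1 f + lsum l2 f.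
Proof. induction l1; simpl; lra. Qed.

Lemma lsum_map {A B} (h : A -> B) (l : list A) f :
  lsum (map h l) f = lsum l (fun a => f (h a)).
Proof. induction l; simpl; lra. Qed.

Lemma lsum_flat_map {A B} (h : A -> list B) (l : list A) f :
  lsum (flat_map h l) f = lsum l (fun a => lsum (h a) f).
Proof. induction l as [|a l IH]; simpl; [lra|]. rewrite lsum_app, IH; lra. Qed.

Lemma lsum_list_prod {A B} (l : list A) (l' : list B) f :
  lsum (list_prod l l') f = lsum l (fun a => lsum l' (fun b => f (a, b))).
Proof.
  induction l as [|a l IH]; simpl; [reflexivity|]. rewrite lsum_app, lsum_map, IH; reflexivity.
Qed.

Lemma lsum_swap {A B} (l : list A) (l' : list B) f :
  lsum l (fun a => lsum l' (f a)) = lsum l' (fun b => lsum l (fun a => f a b)).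
Proof.
  induction l as [|a l IH]; simpl; [now rewrite lsum_0|].
  rewrite IH, lsum_plus; reflexivity.
Qed.

Lemma lsum_Rabs {A} (l : list A) f : Rabs (lsum l f) <= lsum l (fun a => Rabs (f a)).
Proof.
  induction l as [|a l IH]; simpl; [rewrite Rabs_R0; lra|].
  eapply Rle_trans; [apply Rabs_triang|lra].
Qed.

Lemma lsum_Permutation {A} (l l' : list A) f :
  Permutation l l' -> lsum l f = lsum l' f.
Proof. induction 1; simpl; lra. Qed.

Lemma lsum_seq_S n f : lsum (seq 0 (S n)) f = lsum (seq 0 n) f + f n.
Proof. rewrite seq_S, lsum_app; simpl; lra. Qed.

Lemma lsum_seq_add n m f :
  lsum (seq 0 (n + m)) f = lsum (seq 0 n) f + lsum (seq 0 m) (fun i => f (n + i)%nat).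
Proof.
  induction m as [|m IH]; [rewrite Nat.add_0_r; simpl; lra|].
  rewrite Nat.add_succ_r, !lsum_seq_S, IH; lra.
Qed.

(** Indices are written as [i + n * l] with the residue [i] outermost. This one splitting serves the
    Chinese remainder theorem, the removal of a lowest digit and the cutting into blocks. *)
Lemma lsum_seq_mul n m f :
  lsum (seq 0 (n * m)) f =
  lsum (seq 0 n) (fun i => lsum (seq 0 m) (fun l => f (i + n * l)%nat)).
Proof.
  rewrite (lsum_swap (seq 0 n) (seq 0 m) (fun i l => f (i + n * l)%nat)).
  induction m as [|m IH]; [rewrite Nat.mul_0_r; reflexivity|].
  rewrite Nat.mul_succ_r, lsum_seq_add, lsum_seq_S, IH. f_equal.
  apply lsum_ext; intros i; f_equal; lia.
Qed.

Lemma lsum_seq_le n m f :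
  (forall i, 0 <= f i) -> (n <= m)%nat -> lsum (seq 0 n) f <= lsum (seq 0 m) f.
Proof.
  intros Hf H. replace m with (n + (m - n))%nat by lia. rewrite lsum_seq_add.
  assert (0 <= lsum (seq 0 (m - n)) (fun i => f (n + i)%nat)).
  { apply lsum_nonneg; intros; apply Hf. }
  lra.
Qed.

Lemma sum_f_R0_lsum f n : sum_f_R0 f n = lsum (seq 0 (S n)) f.
Proof.
  induction n as [|n IH]; [simpl; lra|]. rewrite lsum_seq_S, <- IH; reflexivity.
Qed.

Lemma nsum_lsum d g : nsum d g = lsum (seq 0 d) g.
Proof. induction d as [|d IH]; [reflexivity|]. rewrite lsum_seq_S, <- IH; reflexivity. Qed.

Lemma fold_Rplus_lsum {A} (l : list A) f : fold_right Rplus 0 (map f l) = lsum l f.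
Proof. induction l as [|a l IH]; simpl; [reflexivity|now rewrite IH]. Qed.

(** * Indicators and counting *)

Definition indic (b : bool) : R := if b then 1 else 0.

Lemma indic_nonneg b : 0 <= indic b.
Proof. destruct b; simpl; lra. Qed.

Lemma indic_andb b c : indic (b && c) = indic b * indic c.
Proof. destruct b, c; simpl; lra. Qed.

Lemma lsum_indic_eqb n c : lsum (seq 0 n) (fun b => indic (b =? c)%nat) = indic (c <? n)%nat.
Proof.
  induction n as [|n IH]; [simpl; destruct (Nat.ltb_spec c 0); [lia|reflexivity]|].
  rewrite lsum_seq_S, IH; unfold indic.
  destruct (Nat.ltb_spec c n), (Nat.eqb_spec n c), (Nat.ltb_spec c (S n)); lra || lia.
Qed.

Lemma lsum_indic_ltb n m : (m <= n)%nat -> lsum (seq 0 n) (fun a => indic (a <? m)%nat) = INR m.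
Proof.
  intros H. replace n with (m + (n - m))%nat by lia. rewrite lsum_seq_add.
  rewrite (lsum_ext_in (seq 0 m) _ (fun _ => 1)).
  - rewrite (lsum_ext_in (seq 0 (n - m)) _ (fun _ => 0)).
    + rewrite lsum_0, lsum_const, length_seq; lra.
    + intros a _. unfold indic. destruct (Nat.ltb_spec (m + a) m); [lia|reflexivity].
  - intros a Ha%in_seq. unfold indic. destruct (Nat.ltb_spec a m); [reflexivity|lia].
Qed.

(** * Sums of periodic functions over residue classes *)

Lemma periodic_mod (Q : nat) (v : nat -> R) :
  (forall l, v (l + Q)%nat = v l) -> forall l, v (l mod Q) = v l.
Proof.
  intros Hv l.
  assert (H : forall k a, v (a + k * Q)%nat = v a).
  { induction k as [|k IH]; intros a; [f_equal; lia|].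
    replace (a + S k * Q)%nat with ((a + k * Q) + Q)%nat by lia.
    rewrite Hv; apply IH. }
  rewrite <- (H (l / Q)%nat (l mod Q)). f_equal.
  rewrite (Nat.div_mod_eq l Q) at 3. lia.
Qed.

(** Since [P] is a unit modulo [Q], the map [l -> i + P * l] permutes the residues. With [P = 1]
    this is the shift invariance used for grids and for blocks of Halton points. *)
Lemma lsum_periodic_affine (P Q i : nat) (v : nat -> R) :
  (0 < Q)%nat -> Nat.gcd P Q = 1%nat -> (forall l, v (l + Q)%nat = v l) ->
  lsum (seq 0 Q) (fun l => v (i + P * l)%nat) = lsum (seq 0 Q) v.
Proof.
  intros HQ Hg Hv.
  transitivity (lsum (map (fun l => ((i + P * l) mod Q)%nat) (seq 0 Q)) v).
  { rewrite lsum_map. apply lsum_ext; intros l. now rewrite periodic_mod. }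
  (* A duplicate-free list of length [Q] contained in [seq 0 Q] is a permutation of it; Gauss's
     lemma gives injectivity. *)
  apply lsum_Permutation, NoDup_Permutation_bis.
  - apply NoDup_map_NoDup_ForallPairs; [|apply seq_NoDup].
    assert (W : forall a b, (a < b)%nat -> (b < Q)%nat ->
      ((i + P * a) mod Q)%nat <> ((i + P * b) mod Q)%nat).
    { intros a b Hab Hb E.
      assert (D : Nat.divide Q (P * (b - a))).
      { pose proof (Nat.div_mod_eq (i + P * a) Q) as E1.
        pose proof (Nat.div_mod_eq (i + P * b) Q) as E2.
        exists ((i + P * b) / Q - (i + P * a) / Q)%nat.
        rewrite Nat.mul_sub_distr_r, Nat.mul_sub_distr_l. rewrite E in E1. lia. }
      apply Nat.gauss in D; [|rewrite Nat.gcd_comm; exact Hg].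
      apply Nat.divide_pos_le in D; lia. }
    intros a b Ha%in_seq Hb%in_seq E.
    destruct (Nat.lt_trichotomy a b) as [H|[H|H]]; [|exact H|].
    + exfalso; apply (W a b); [exact H|lia|exact E].
    + exfalso; apply (W b a); [exact H|lia|symmetry; exact E].
  - rewrite length_map; reflexivity.
  - intros x (l & <- & _)%in_map_iff. apply in_seq.
    pose proof (Nat.mod_upper_bound (i + P * l) Q). lia.
Qed.

(* The Chinese remainder theorem in summed form. *)
Lemma lsum_coprime_mul (P Q : nat) (u v : nat -> R) :
  (0 < P)%nat -> (0 < Q)%nat -> Nat.gcd P Q = 1%nat ->
  (forall l, u (l + P)%nat = u l) -> (forall l, v (l + Q)%nat = v l) ->
  lsum (seq 0 (P * Q)) (fun r => u r * v r) = lsum (seq 0 P) u * lsum (seq 0 Q) v.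
Proof.
  intros HP HQ Hg Hu Hv. rewrite lsum_seq_mul, <- lsum_scal_r.
  apply lsum_ext; intros i.
  rewrite <- (lsum_periodic_affine P Q i v HQ Hg Hv), <- lsum_scal.
  apply lsum_ext; intros l. f_equal.
  rewrite <- (periodic_mod P u Hu (i + P * l)), <- (periodic_mod P u Hu i).
  f_equal. rewrite Nat.mul_comm, Nat.Div0.mod_add. reflexivity.
Qed.

(** * A discrete Bernstein formula *)

(** One notation for three uses: points of the [N]-grid, endpoints of boxes of side [node P 1], and
    coordinates of Halton points. *)
Definition node (N k : nat) : R := 2 * PI * INR k / INR N.

Lemma cos_sin_period_Z (r : Z) (x : R) :
  cos (x + IZR r * (2 * PI)) = cos x /\ sin (x + IZR r * (2 * PI)) = sin x.
Proof.
  assert (G : forall n y, cos (y + INR n * (2 * PI)) = cos y /\ sin (y + INR n * (2 * PI)) = sin y).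
  { intros n y. replace (y + INR n * (2 * PI)) with (y + 2 * INR n * PI) by ring.
    split; [apply cos_period|apply sin_period]. }
  destruct (Z_le_dec 0 r) as [Hr|Hr].
  - rewrite <- (Z2Nat.id r) by lia. rewrite <- INR_IZR_INZ. apply G.
  - destruct (G (Z.to_nat (- r)) (x + IZR r * (2 * PI))) as [<- <-].
    rewrite INR_IZR_INZ, Z2Nat.id, opp_IZR by lia.
    replace (x + IZR r * (2 * PI) + - IZR r * (2 * PI)) with x by ring. auto.
Qed.

(** The factor [2 * sin (x / 2)] turns each term into a difference of values at half-integer
    multiples of [x]; this is the Dirichlet kernel in closed form, without a division. *)
Lemma lsum_trig_telescope (x : R) (n : nat) :
  2 * sin (x / 2) * lsum (seq 0 n) (fun k => cos (INR k * x)) =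
    sin (INR n * x - x / 2) + sin (x / 2) /\
  2 * sin (x / 2) * lsum (seq 0 n) (fun k => sin (INR k * x)) =
    cos (x / 2) - cos (INR n * x - x / 2).
Proof.
  induction n as [|n [IHc IHs]].
  - simpl. replace (0 * x - x / 2) with (- (x / 2)) by lra.
    rewrite sin_neg, cos_neg. lra.
  - rewrite !lsum_seq_S, !Rmult_plus_distr_l, IHc, IHs, S_INR.
    replace ((INR n + 1) * x - x / 2) with (INR n * x + x / 2) by lra.
    rewrite !cos_plus, !sin_plus, !cos_minus, !sin_minus. lra.
Qed.

(** Orthogonality of the characters of Z/N. The bound on [r] excludes aliasing: a nonzero [r] is not
    a multiple of [N], so the telescoping factor does not vanish. *)
Lemma lsum_node (N : nat) (r : Z) : (Z.abs r < Z.of_nat N)%Z ->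
  lsum (seq 0 N) (fun k => cos (IZR r * node N k)) = INR N * indic (r =? 0)%Z /\
  lsum (seq 0 N) (fun k => sin (IZR r * node N k)) = 0.
Proof.
  intros Hr. assert (HN : 0 < INR N) by (apply lt_0_INR; lia).
  destruct (Z.eqb_spec r 0) as [->|Hr0].
  - simpl indic. split.
    + rewrite (lsum_ext _ _ (fun _ => 1)); [rewrite lsum_const, length_seq; lra|].
      intros k. rewrite Rmult_0_l; apply cos_0.
    + rewrite (lsum_ext _ _ (fun _ => 0)); [apply lsum_0|].
      intros k. rewrite Rmult_0_l; apply sin_0.
  - set (x := IZR r * node N 1).
    assert (Hx : forall k, IZR r * node N k = INR k * x).
    { intros k. unfold x, node. simpl (INR 1). field. lra. }
    assert (Hs : sin (x / 2) <> 0).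
    { intros Hs.
      assert (Hx2 : x / 2 = PI * (IZR r / INR N)).
      { unfold x, node; simpl (INR 1); field; lra. }
      rewrite Hx2 in Hs. pose proof PI_RGT_0 as HPI.
      assert (Hb : forall m : Z, (0 < m < Z.of_nat N)%Z -> sin (PI * (IZR m / INR N)) > 0).
      { intros m [Hm1 Hm2].
        assert (0 < IZR m / INR N < 1).
        { split.
          - apply Rdiv_lt_0_compat; [apply IZR_lt in Hm1; exact Hm1|exact HN].
          - apply Rmult_lt_reg_r with (INR N); [exact HN|].
            unfold Rdiv; rewrite Rmult_assoc, Rinv_l, Rmult_1_r, Rmult_1_l by lra.
            rewrite INR_IZR_INZ; apply IZR_lt; exact Hm2. }
        apply sin_gt_0; nra. }
      destruct (Z_lt_dec 0 r) as [H|H].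
      - specialize (Hb r ltac:(lia)); lra.
      - specialize (Hb (- r)%Z ltac:(lia)). rewrite opp_IZR in Hb.
        replace (PI * (- IZR r / INR N)) with (- (PI * (IZR r / INR N))) in Hb by (field; lra).
        rewrite sin_neg in Hb; lra. }
    rewrite (lsum_ext _ (fun k => cos (IZR r * node N k)) (fun k => cos (INR k * x)))
      by (intros k; now rewrite Hx).
    rewrite (lsum_ext _ (fun k => sin (IZR r * node N k)) (fun k => sin (INR k * x)))
      by (intros k; now rewrite Hx).
    destruct (lsum_trig_telescope x N) as [Tc Ts].
    destruct (cos_sin_period_Z r (- (x / 2))) as [E1 E2].
    (* As [N * x] equals [2 * PI * r], the two ends of the telescoping sums cancel. *)
    replace (INR N * x - x / 2) with (- (x / 2) + IZR r * (2 * PI)) in Tc, Ts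
      by (unfold x, node; simpl (INR 1); field; lra).
    rewrite E2, sin_neg in Tc. rewrite E1, cos_neg in Ts.
    simpl indic. split; apply (Rmult_eq_reg_l (2 * sin (x / 2))); lra.
Qed.

(** The Fejer kernel as the squared modulus of a geometric sum of exponentials, divided by [n];
    nonnegativity is visible in this form. *)
Definition fejer (n : nat) (t : R) : R :=
  ((lsum (seq 0 n) (fun a => cos (INR a * t)))² +
   (lsum (seq 0 n) (fun a => sin (INR a * t)))²) / INR n.

Lemma fejer_nonneg n t : (0 < n)%nat -> 0 <= fejer n t.
Proof.
  intros Hn. apply Rmult_le_pos; [|left; apply Rinv_0_lt_compat, lt_0_INR; exact Hn].
  apply Rplus_le_le_0_compat; apply Rle_0_sqr.
Qed.

Lemma fejer_double_sum n t :
  fejer n t =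
  / INR n * lsum (seq 0 n) (fun a => lsum (seq 0 n) (fun b => cos (IZR (Z.of_nat a - Z.of_nat b) * t))).
Proof.
  unfold fejer, Rdiv. rewrite Rmult_comm. f_equal. unfold Rsqr.
  rewrite <- !lsum_scal_r, <- lsum_plus. apply lsum_ext; intros a.
  rewrite <- !lsum_scal, <- lsum_plus. apply lsum_ext; intros b.
  rewrite minus_IZR, <- !INR_IZR_INZ, Rmult_minus_distr_r, cos_minus. reflexivity.
Qed.

(** The coefficient at [r] is the number of pairs with [b - a = r], divided by [n]; it is left as a
    count rather than as the tent function. The size condition keeps every frequency [r + a - b] and
    [r - a + b] below [N] in absolute value. *)
Lemma fejer_moments (n N : nat) (r : Z) :
  (0 < n)%nat -> (Z.abs r + Z.of_nat n <= Z.of_nat N)%Z ->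
  lsum (seq 0 N) (fun k => cos (IZR r * node N k) * fejer n (node N k)) =
    INR N / INR n *
    lsum (seq 0 n) (fun a => lsum (seq 0 n)
      (fun b => indic (Z.of_nat b =? r + Z.of_nat a)%Z)) /\
  lsum (seq 0 N) (fun k => sin (IZR r * node N k) * fejer n (node N k)) = 0.
Proof.
  intros Hn Hr.
  assert (Hn' : 0 < INR n) by (apply lt_0_INR; lia).
  assert (E : forall (g : R -> R),
    lsum (seq 0 N) (fun k => g (node N k) * fejer n (node N k)) =
    / INR n * lsum (seq 0 n) (fun a => lsum (seq 0 n) (fun b =>
       lsum (seq 0 N) (fun k => g (node N k) * cos (IZR (Z.of_nat a - Z.of_nat b) * node N k))))).
  { intros g. rewrite <- lsum_scal.
    rewrite (lsum_ext _ _ (fun k => lsum (seq 0 n) (fun a => / INR n * lsum (seq 0 n) (fun b =>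
      g (node N k) * cos (IZR (Z.of_nat a - Z.of_nat b) * node N k))))).
    - rewrite lsum_swap. apply lsum_ext; intros a.
      rewrite lsum_scal. f_equal. apply lsum_swap.
    - intros k. rewrite fejer_double_sum, lsum_scal.
      rewrite <- Rmult_assoc, (Rmult_comm (g _)), Rmult_assoc. f_equal.
      rewrite <- lsum_scal. apply lsum_ext; intros a. now rewrite lsum_scal. }
  rewrite (E (fun t => cos (IZR r * t))), (E (fun t => sin (IZR r * t))).
  split.
  - unfold Rdiv. rewrite (Rmult_comm (INR N)), Rmult_assoc. f_equal.
    assert (S : lsum (seq 0 n) (fun a => lsum (seq 0 n) (fun b => indic (Z.of_nat b =? r + Z.of_nat a)%Z))
     = lsum (seq 0 n) (fun a => lsum (seq 0 n) (fun b => indic (Z.of_nat a =? r + Z.of_nat b)%Z)))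
     by apply lsum_swap.
    (* The product formula for cosines produces both frequencies [r + a - b] and [r - a + b], so the
       count is first symmetrized in [a] and [b]. *)
    transitivity (INR N / 2 * (
      lsum (seq 0 n) (fun a => lsum (seq 0 n) (fun b => indic (Z.of_nat b =? r + Z.of_nat a)%Z))
     + lsum (seq 0 n) (fun a => lsum (seq 0 n) (fun b => indic (Z.of_nat a =? r + Z.of_nat b)%Z)))).
    2: { rewrite <- S; lra. }
    rewrite <- lsum_plus, <- lsum_scal. apply lsum_ext_in; intros a Ha%in_seq.
    rewrite <- lsum_plus, <- lsum_scal. apply lsum_ext_in; intros b Hb%in_seq.
    rewrite (lsum_ext _ _ (fun k => / 2 * (cos (IZR (r + Z.of_nat a - Z.of_nat b) * node N k)
        + cos (IZR (r - Z.of_nat a + Z.of_nat b) * node N k)))).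
    + rewrite lsum_scal, lsum_plus.
      destruct (lsum_node N (r + Z.of_nat a - Z.of_nat b) ltac:(lia)) as [-> _].
      destruct (lsum_node N (r - Z.of_nat a + Z.of_nat b) ltac:(lia)) as [-> _].
      replace (r + Z.of_nat a - Z.of_nat b =? 0)%Z with (Z.of_nat b =? r + Z.of_nat a)%Z
        by (apply Bool.eq_iff_eq_true; rewrite !Z.eqb_eq; lia).
      replace (r - Z.of_nat a + Z.of_nat b =? 0)%Z with (Z.of_nat a =? r + Z.of_nat b)%Z
        by (apply Bool.eq_iff_eq_true; rewrite !Z.eqb_eq; lia).
      field.
    + intros k. rewrite ?plus_IZR, ?minus_IZR, ?plus_IZR, ?minus_IZR.
      set (A := IZR (Z.of_nat a)); set (B := IZR (Z.of_nat b)); set (t := node N k).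
      replace ((IZR r + A - B) * t) with (IZR r * t + (A - B) * t) by ring.
      replace ((IZR r - A + B) * t) with (IZR r * t - (A - B) * t) by ring.
      rewrite cos_plus, cos_minus. field.
  - rewrite (lsum_ext_in (seq 0 n) _ (fun _ => 0)); [rewrite lsum_0; lra|].
    intros a Ha%in_seq.
    rewrite (lsum_ext_in (seq 0 n) _ (fun _ => 0)); [apply lsum_0|].
    intros b Hb%in_seq.
    rewrite (lsum_ext _ _ (fun k => / 2 * (sin (IZR (r + Z.of_nat a - Z.of_nat b) * node N k)
        + sin (IZR (r - Z.of_nat a + Z.of_nat b) * node N k)))).
    + rewrite lsum_scal, lsum_plus.
      destruct (lsum_node N (r + Z.of_nat a - Z.of_nat b) ltac:(lia)) as [_ ->].
      destruct (lsum_node N (r - Z.of_nat a + Z.of_nat b) ltac:(lia)) as [_ ->].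
      lra.
    + intros k. rewrite ?plus_IZR, ?minus_IZR, ?plus_IZR, ?minus_IZR.
      set (A := IZR (Z.of_nat a)); set (B := IZR (Z.of_nat b)); set (t := node N k).
      replace ((IZR r + A - B) * t) with (IZR r * t + (A - B) * t) by ring.
      replace ((IZR r - A + B) * t) with (IZR r * t - (A - B) * t) by ring.
      rewrite sin_plus, sin_minus. field.
Qed.

(* The Fourier coefficients of [-2n sin(nt) fejer n t] are [i m] for [|m| <= n], so
   convolution with it differentiates polynomials of degree at most [n]. *)
Definition bern (n N k : nat) : R :=
  - (2 * INR n / INR N) * (sin (INR n * node N k) * fejer n (node N k)).

(** Bounding the sine by 1 leaves the nonnegative Fejer kernel, whose sum over the grid is its
    moment at 0, namely [N]. *)
Lemma bern_mass (n N : nat) : (0 < n)%nat -> (4 * n <= N)%nat ->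
  lsum (seq 0 N) (fun k => Rabs (bern n N k)) <= 2 * INR n.
Proof.
  intros Hn HN.
  assert (Hn' : 0 < INR n) by (apply lt_0_INR; lia).
  assert (HN' : 0 < INR N) by (apply lt_0_INR; lia).
  apply Rle_trans with
    (lsum (seq 0 N) (fun k => 2 * INR n / INR N * (cos (IZR 0 * node N k) * fejer n (node N k)))).
  - apply lsum_le; intros k _. unfold bern.
    assert (Hc : 0 < 2 * INR n / INR N) by (apply Rdiv_lt_0_compat; lra).
    rewrite !Rabs_mult, Rabs_Ropp, (Rabs_pos_eq (2 * INR n / INR N)) by lra.
    apply Rmult_le_compat_l; [lra|].
    rewrite Rmult_0_l, cos_0, (Rabs_pos_eq (fejer _ _)) by (apply fejer_nonneg; exact Hn).
    apply Rmult_le_compat_r; [apply fejer_nonneg; exact Hn|].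
    apply Rabs_le. apply SIN_bound.
  - rewrite lsum_scal. destruct (fejer_moments n N 0 Hn ltac:(lia)) as [-> _].
    rewrite (lsum_ext_in (seq 0 n) _ (fun _ => 1)).
    + rewrite lsum_const, length_seq. right. field. lra.
    + intros a Ha%in_seq.
      transitivity (indic (a <? n)%nat).
      * rewrite <- lsum_indic_eqb. apply lsum_ext; intros b. f_equal.
        apply Bool.eq_iff_eq_true; rewrite Z.eqb_eq, Nat.eqb_eq; lia.
      * unfold indic. destruct (Nat.ltb_spec a n); [reflexivity|lia].
Qed.

(** Multiplying by [sin (n t)] moves the frequency [m] to [n - m] and [n + m], where the Fejer
    coefficients are [m / n] and 0. The linear slope of the tent function thus becomes the factor of
    differentiation. *)
Lemma bern_moments_nat (n N m : nat) : (0 < n)%nat -> (4 * n <= N)%nat -> (m < n)%nat ->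
  lsum (seq 0 N) (fun k => bern n N k * cos (INR m * node N k)) = 0 /\
  lsum (seq 0 N) (fun k => bern n N k * sin (INR m * node N k)) = - INR m.
Proof.
  intros Hn HN Hm.
  assert (Hn' : 0 < INR n) by (apply lt_0_INR; lia).
  assert (HN' : 0 < INR N) by (apply lt_0_INR; lia).
  destruct (fejer_moments n N (Z.of_nat n - Z.of_nat m) Hn ltac:(lia)) as [C1 S1].
  destruct (fejer_moments n N (Z.of_nat n + Z.of_nat m) Hn ltac:(lia)) as [C2 S2].
  rewrite minus_IZR, <- !INR_IZR_INZ in C1, S1.
  rewrite plus_IZR, <- !INR_IZR_INZ in C2, S2.
  split.
  - rewrite (lsum_ext _ _ (fun k => - (INR n / INR N) *
      (sin ((INR n - INR m) * node N k) * fejer n (node N k) +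
       sin ((INR n + INR m) * node N k) * fejer n (node N k)))).
    + rewrite lsum_scal, lsum_plus, S1, S2. lra.
    + intros k. unfold bern.
      rewrite Rmult_plus_distr_r, Rmult_minus_distr_r, sin_plus, sin_minus. field. lra.
  - rewrite (lsum_ext _ _ (fun k => - (INR n / INR N) *
      (cos ((INR n - INR m) * node N k) * fejer n (node N k) -
       cos ((INR n + INR m) * node N k) * fejer n (node N k)))).
    + rewrite lsum_scal, lsum_minus, C1, C2.
      rewrite (lsum_ext_in (seq 0 n) (fun a => lsum (seq 0 n)
         (fun b => indic (Z.of_nat b =? Z.of_nat n + Z.of_nat m + Z.of_nat a)%Z)) (fun _ => 0)).
      * rewrite (lsum_ext_in (seq 0 n) (fun a => lsum (seq 0 n)
         (fun b => indic (Z.of_nat b =? Z.of_nat n - Z.of_nat m + Z.of_nat a)%Z))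
         (fun a => indic (a <? m)%nat)).
        -- rewrite lsum_0, lsum_indic_ltb by lia. field. lra.
        -- intros a Ha%in_seq.
           transitivity (indic (n - m + a <? n)%nat).
           ++ rewrite <- lsum_indic_eqb. apply lsum_ext; intros b. f_equal.
              apply Bool.eq_iff_eq_true; rewrite Z.eqb_eq, Nat.eqb_eq; lia.
           ++ f_equal. apply Bool.eq_iff_eq_true; rewrite !Nat.ltb_lt; lia.
      * intros a Ha%in_seq.
        rewrite (lsum_ext_in (seq 0 n) _ (fun _ => 0)); [apply lsum_0|].
        intros b Hb%in_seq. unfold indic.
        destruct (Z.eqb_spec (Z.of_nat b) (Z.of_nat n + Z.of_nat m + Z.of_nat a)); [lia|reflexivity].
    + intros k. unfold bern.
      rewrite Rmult_plus_distr_r, Rmult_minus_distr_r, cos_plus, cos_minus. field. lra.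
Qed.

Lemma bern_moments (n N : nat) (m : Z) : (4 * n <= N)%nat -> (Z.abs m < Z.of_nat n)%Z ->
  lsum (seq 0 N) (fun k => bern n N k * cos (IZR m * node N k)) = 0 /\
  lsum (seq 0 N) (fun k => bern n N k * sin (IZR m * node N k)) = - IZR m.
Proof.
  intros HN Hm.
  destruct (bern_moments_nat n N (Z.to_nat (Z.abs m)) ltac:(lia) HN ltac:(lia)) as [C S].
  rewrite INR_IZR_INZ, Z2Nat.id in C, S by lia.
  destruct (Z_le_dec 0 m) as [H|H].
  - rewrite Z.abs_eq in C, S by lia. split; assumption.
  - rewrite Z.abs_neq, opp_IZR in C, S by lia. split.
    + rewrite <- C. apply lsum_ext; intros k.
      rewrite Ropp_mult_distr_l_reverse, cos_neg; reflexivity.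
    + rewrite (lsum_ext _ _ (fun k => -1 * (bern n N k * sin (- IZR m * node N k)))).
      * rewrite lsum_scal, S; lra.
      * intros k. rewrite <- Ropp_mult_distr_l, sin_neg. lra.
Qed.

(** Convolution with [bern] over the grid differentiates the frequency [m] exactly, an interpolation
    formula in the manner of M. Riesz. *)
Lemma bern_derivative (n N : nat) (m : Z) (th : R) :
  (4 * n <= N)%nat -> (Z.abs m < Z.of_nat n)%Z ->
  lsum (seq 0 N) (fun k => bern n N k * cos (th - IZR m * node N k)) = - IZR m * sin th /\
  lsum (seq 0 N) (fun k => bern n N k * sin (th - IZR m * node N k)) = IZR m * cos th.
Proof.
  intros HN Hm. destruct (bern_moments n N m HN Hm) as [C S]. split.
  - rewrite (lsum_ext _ _ (fun k => cos th * (bern n N k * cos (IZR m * node N k)) +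
      sin th * (bern n N k * sin (IZR m * node N k)))).
    + rewrite lsum_plus, !lsum_scal, C, S. lra.
    + intros k. rewrite cos_minus. ring.
  - rewrite (lsum_ext _ _ (fun k => sin th * (bern n N k * cos (IZR m * node N k)) -
      cos th * (bern n N k * sin (IZR m * node N k)))).
    + rewrite lsum_minus, !lsum_scal, C, S. lra.
    + intros k. rewrite sin_minus. ring.
Qed.

(** * Local oscillation of trigonometric polynomials *)

Lemma upd_same {A} (k : nat -> A) j z : upd k j z j = z.
Proof. unfold upd; now rewrite Nat.eqb_refl. Qed.

Lemma upd_other {A} (k : nat -> A) j z i : i <> j -> upd k j z i = k i.
Proof. intros H; unfold upd; destruct (Nat.eqb_spec i j); [contradiction|reflexivity]. Qed.

Lemma upd_upd {A} (k : nat -> A) j z z' : upd (upd k j z) j z' = upd k j z'.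
Proof. apply functional_extensionality; intros i; unfold upd; now destruct (Nat.eqb i j). Qed.

Lemma upd_comm {A} (k : nat -> A) i j z z' : i <> j ->
  upd (upd k i z) j z' = upd (upd k j z') i z.
Proof.
  intros H. apply functional_extensionality; intros l; unfold upd.
  destruct (Nat.eqb_spec l j), (Nat.eqb_spec l i); congruence.
Qed.

(** * Frequency boxes and evaluation of trigonometric polynomials *)

Definition zlist (M : nat) : list Z :=
  map (fun t => (Z.of_nat t - (Z.of_nat M - 1))%Z) (seq 0 (S (2 * M - 2))).

Fixpoint boxlist (d : nat) (s : nat -> nat) : list (nat -> Z) :=
  match d with
  | O => (fun _ => 0%Z) :: nil
  | S d' => flat_map (fun k => map (upd k d') (zlist (2 ^ s d'))) (boxlist d' s)
  end.

Lemma box_sum_lsum d s F : box_sum d s F = lsum (boxlist d s) F.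
Proof.
  revert F; induction d as [|d IH]; intros F; [simpl; lra|].
  cbn [box_sum boxlist]. rewrite IH, lsum_flat_map. apply lsum_ext; intros k.
  cbv beta. rewrite lsum_map. unfold zsum, zlist. now rewrite sum_f_R0_lsum, lsum_map.
Qed.

Lemma in_boxlist d s k : In k (boxlist d s) ->
  forall j, (j < d)%nat -> (Z.abs (k j) < Z.of_nat (2 ^ s j))%Z.
Proof.
  revert k; induction d as [|d IH]; intros k Hk j Hj; [lia|].
  cbn [boxlist] in Hk. apply in_flat_map in Hk as (k' & Hk' & (z & <- & Hz)%in_map_iff).
  destruct (Nat.eq_dec j d) as [->|Hjd].
  - rewrite upd_same. unfold zlist in Hz.
    apply in_map_iff in Hz as (t & <- & Ht%in_seq).
    (* The power is at least 1, so the natural subtraction in [2 * M - 2] is not truncated. *)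
    pose proof (Nat.pow_nonzero 2 (s d)). lia.
  - rewrite upd_other by exact Hjd. apply IH; [exact Hk'|lia].
Qed.

Lemma dotZ_line d k y h t :
  dotZ d k (fun j => y j + t * h j) = dotZ d k y + t * dotZ d k h.
Proof. unfold dotZ. induction d as [|d IH]; simpl; [ring|rewrite IH; ring]. Qed.

Lemma dotZ_upd d k x j v : (j < d)%nat ->
  dotZ d k (upd x j v) = dotZ d k x + IZR (k j) * (v - x j).
Proof.
  unfold dotZ. intros Hj. induction d as [|d IH]; [lia|]. simpl.
  destruct (Nat.eq_dec j d) as [->|Hjd].
  - rewrite upd_same.
    assert (E : forall e, (e <= d)%nat ->
      nsum e (fun i => IZR (k i) * upd x d v i) = nsum e (fun i => IZR (k i) * x i)).
    { induction e as [|e IHe]; intros He; simpl; [reflexivity|].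
      rewrite IHe, upd_other by lia. reflexivity. }
    rewrite E by lia. ring.
  - rewrite IH, upd_other by lia. ring.
Qed.

(** The imaginary part of f is the real part of -i f, so facts proved for [tp_re] with arbitrary
    coefficients carry over to [tp_im]. *)
Lemma tp_im_re d s a b x : tp_im d s a b x = tp_re d s b (fun k => - a k) x.
Proof. unfold tp_im, tp_re. rewrite !box_sum_lsum. apply lsum_ext; intros k; ring. Qed.

(** * Periodicity and boundedness *)

Lemma dotZ_shift d k x (z : nat -> Z) : exists w : Z,
  dotZ d k (fun j => x j + IZR (z j) * (2 * PI)) = dotZ d k x + IZR w * (2 * PI).
Proof.
  unfold dotZ. induction d as [|d [w IH]]; [exists 0%Z; simpl; ring|].
  exists (w + k d * z d)%Z. simpl. rewrite IH, plus_IZR, mult_IZR. ring.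
Qed.

Lemma tp_re_shift d s a b x (z : nat -> Z) :
  tp_re d s a b (fun j => x j + IZR (z j) * (2 * PI)) = tp_re d s a b x.
Proof.
  unfold tp_re. rewrite !box_sum_lsum. apply lsum_ext; intros k.
  destruct (dotZ_shift d k x z) as [w ->].
  destruct (cos_sin_period_Z w (dotZ d k x)) as [-> ->]. reflexivity.
Qed.

Lemma tp_abs_shift d s a b x (z : nat -> Z) :
  tp_abs d s a b (fun j => x j + IZR (z j) * (2 * PI)) = tp_abs d s a b x.
Proof. unfold tp_abs. now rewrite !tp_im_re, !tp_re_shift. Qed.

Lemma tp_abs_periodic d s a b x j :
  tp_abs d s a b (upd x j (x j + 2 * PI)) = tp_abs d s a b x.
Proof.
  rewrite <- (tp_abs_shift d s a b x (upd (fun _ => 0%Z) j 1%Z)). f_equal.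
  apply functional_extensionality; intros i. unfold upd.
  destruct (Nat.eqb_spec i j) as [->|_]; ring.
Qed.

Lemma tp_abs_torus d s a b x : exists x', in_torus d x' /\ tp_abs d s a b x' = tp_abs d s a b x.
Proof.
  exists (fun j => x j + IZR (- Int_part (x j / (2 * PI))) * (2 * PI)).
  split; [|apply tp_abs_shift]. intros j _.
  destruct (base_Int_part (x j / (2 * PI))) as [H1 H2]. rewrite opp_IZR.
  set (z := IZR _) in *. pose proof PI_RGT_0 as HPI.
  replace (x j) with (x j / (2 * PI) * (2 * PI)) by (field; lra).
  nra.
Qed.

Lemma tp_abs_nonneg d s a b x : 0 <= tp_abs d s a b x.
Proof. apply sqrt_pos. Qed.

Lemma tp_re_bounded d s a b : exists B, forall x, Rabs (tp_re d s a b x) <= B.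
Proof.
  exists (lsum (boxlist d s) (fun k => Rabs (a k) + Rabs (b k))). intros x.
  unfold tp_re. rewrite box_sum_lsum. eapply Rle_trans; [apply lsum_Rabs|].
  apply lsum_le; intros k _. unfold Rminus.
  eapply Rle_trans; [apply Rabs_triang|]. rewrite Rabs_Ropp, !Rabs_mult.
  assert (Rabs (cos (dotZ d k x)) <= 1) by (apply Rabs_le; apply COS_bound).
  assert (Rabs (sin (dotZ d k x)) <= 1) by (apply Rabs_le; apply SIN_bound).
  pose proof (Rabs_pos (a k)); pose proof (Rabs_pos (b k)). nra.
Qed.

Lemma tp_abs_bounded d s a b : exists B, forall x, tp_abs d s a b x <= B.
Proof.
  destruct (tp_re_bounded d s a b) as [B1 H1].
  destruct (tp_re_bounded d s b (fun k => - a k)) as [B2 H2].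
  exists (B1 + B2). intros x. specialize (H1 x). specialize (H2 x).
  rewrite <- tp_im_re in H2. unfold tp_abs.
  set (u := tp_re d s a b x) in *; set (v := tp_im d s a b x) in *.
  rewrite (Rsqr_abs u), (Rsqr_abs v).
  pose proof (Rabs_pos u); pose proof (Rabs_pos v).
  rewrite <- (sqrt_Rsqr (B1 + B2)) by lra. apply sqrt_le_1_alt.
  assert (Rsqr (Rabs u) <= Rsqr B1) by (apply Rsqr_incr_1; lra).
  assert (Rsqr (Rabs v) <= Rsqr B2) by (apply Rsqr_incr_1; lra).
  unfold Rsqr in *. nra.
Qed.

(** The triangle inequality for the complex modulus in real coordinates; the cross term is bounded
    by Cauchy-Schwarz. *)
Lemma sqrt_Rsqr_plus_triang u v u' v' :
  sqrt (Rsqr u + Rsqr v) <= sqrt (Rsqr u' + Rsqr v') + sqrt (Rsqr (u - u') + Rsqr (v - v')).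
Proof.
  set (A := sqrt (Rsqr u' + Rsqr v')). set (B := sqrt (Rsqr (u - u') + Rsqr (v - v'))).
  assert (HA : 0 <= A) by apply sqrt_pos. assert (HB : 0 <= B) by apply sqrt_pos.
  assert (HA2 : A * A = u' * u' + v' * v').
  { unfold A; rewrite sqrt_sqrt; [reflexivity|apply Rplus_le_le_0_compat; apply Rle_0_sqr]. }
  assert (HB2 : B * B = (u - u') * (u - u') + (v - v') * (v - v')).
  { unfold B; rewrite sqrt_sqrt; [reflexivity|apply Rplus_le_le_0_compat; apply Rle_0_sqr]. }
  assert (HC : u' * (u - u') + v' * (v - v') <= A * B) by apply sqrt_cauchy.
  rewrite <- (sqrt_Rsqr (A + B)) by lra. apply sqrt_le_1_alt. unfold Rsqr. nra.
Qed.

Lemma derivable_pt_lim_lsum {A} (l : list A) (f : A -> R -> R) (f' : A -> R) x :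
  (forall a, In a l -> derivable_pt_lim (f a) x (f' a)) ->
  derivable_pt_lim (fun t => lsum l (fun a => f a t)) x (lsum l f').
Proof.
  induction l as [|a l IH]; intros H; simpl; [apply derivable_pt_lim_const|].
  apply (derivable_pt_lim_plus (f a) (fun t => lsum l (fun a => f a t))).
  - apply H; left; reflexivity.
  - apply IH; intros b Hb; apply H; right; exact Hb.
Qed.

(** The chain rule along a line gives a sum of partial derivatives, and each is replaced by a [bern]
    combination of translates in its own coordinate, which is exact because the frequencies satisfy
    [|k j| < 2 ^ s j]. *)
Lemma tp_re_derivative d s a b N y h t :
  (forall j, (j < d)%nat -> (4 * 2 ^ s j <= N)%nat) ->
  let x := fun j => y j + t * h j in
  derivable_pt_lim (fun t => tp_re d s a b (fun j => y j + t * h j)) t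
    (lsum (seq 0 d) (fun j => h j * lsum (seq 0 N) (fun k =>
       bern (2 ^ s j) N k * tp_re d s a b (upd x j (x j - node N k))))).
Proof.
  intros HN x.
  assert (E : (fun t => tp_re d s a b (fun j => y j + t * h j)) =
    (fun t => lsum (boxlist d s) (fun k =>
      a k * cos (dotZ d k y + t * dotZ d k h) - b k * sin (dotZ d k y + t * dotZ d k h)))).
  { apply functional_extensionality; intros u. unfold tp_re. rewrite box_sum_lsum.
    apply lsum_ext; intros k. now rewrite dotZ_line. }
  rewrite E; clear E.
  (* The derivative is computed frequency by frequency, and this form is then matched with the
     translates. *)
  replace (lsum (seq 0 d) _) with (lsum (boxlist d s) (fun k =>
      (a k * (- sin (dotZ d k x)) - b k * cos (dotZ d k x)) * dotZ d k h)).
  - apply derivable_pt_lim_lsum; intros k _.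
    unfold x; rewrite dotZ_line.
    set (u := dotZ d k y); set (v := dotZ d k h).
    assert (L : derivable_pt_lim (fun t => u + t * v) t (0 + (1 * v + t * 0))).
    { apply (derivable_pt_lim_plus (fun _ => u) (fun t => t * v)).
      - apply derivable_pt_lim_const.
      - apply (derivable_pt_lim_mult id (fun _ => v)).
        + apply derivable_pt_lim_id.
        + apply derivable_pt_lim_const. }
    replace (0 + (1 * v + t * 0)) with v in L by ring.
    rewrite Rmult_minus_distr_r, !Rmult_assoc.
    apply (derivable_pt_lim_minus (fun t => a k * cos (u + t * v)) (fun t => b k * sin (u + t * v))).
    + apply (derivable_pt_lim_scal (fun t => cos (u + t * v))).
      apply (derivable_pt_lim_comp (fun t => u + t * v) cos); [exact L|apply derivable_pt_lim_cos].
    + apply (derivable_pt_lim_scal (fun t => sin (u + t * v))).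
      apply (derivable_pt_lim_comp (fun t => u + t * v) sin); [exact L|apply derivable_pt_lim_sin].
  - rewrite (lsum_ext_in (seq 0 d) _ (fun j => lsum (boxlist d s) (fun k =>
      (a k * (- sin (dotZ d k x)) - b k * cos (dotZ d k x)) * (IZR (k j) * h j)))).
    + rewrite lsum_swap. apply lsum_ext; intros k.
      rewrite lsum_scal. f_equal. unfold dotZ. apply nsum_lsum.
    + intros j Hj%in_seq.
      rewrite (lsum_ext (seq 0 N) _ (fun t => lsum (boxlist d s) (fun k => bern (2 ^ s j) N t *
        (a k * cos (dotZ d k x - IZR (k j) * node N t) - b k * sin (dotZ d k x - IZR (k j) * node N t))))).
      * rewrite lsum_swap, <- lsum_scal. apply lsum_ext_in; intros k Hk.
        destruct (bern_derivative (2 ^ s j) N (k j) (dotZ d k x)) as [Ec Es];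
          [apply HN; lia|apply (in_boxlist d s k Hk); lia|].
        rewrite (lsum_ext _ _ (fun t => a k * (bern (2 ^ s j) N t * cos (dotZ d k x - IZR (k j) * node N t))
          - b k * (bern (2 ^ s j) N t * sin (dotZ d k x - IZR (k j) * node N t)))) by (intros; ring).
        rewrite lsum_minus, !lsum_scal, Ec, Es. ring.
      * intros u. unfold tp_re. rewrite box_sum_lsum, <- lsum_scal.
        apply lsum_ext; intros k. rewrite dotZ_upd by lia.
        replace (dotZ d k x + IZR (k j) * (x j - node N u - x j))
          with (dotZ d k x - IZR (k j) * node N u) by ring.
        reflexivity.
Qed.

(** * Oscillation between nearby points *)

Definition near (d : nat) (delta : nat -> R) (x y : nat -> R) : Prop :=
  forall j, (j < d)%nat -> Rabs (x j - y j) <= delta j.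

Definition osc_bound (d : nat) (s : nat -> nat) (N : nat) (delta : nat -> R)
    (M : (nat -> R) -> R) (y : nat -> R) : R :=
  lsum (seq 0 d) (fun j => lsum (seq 0 N) (fun k =>
    delta j * Rabs (bern (2 ^ s j) N k) * M (upd y j (y j - node N k)))).

(** The mean value theorem is applied to the real projection of f onto the direction of f(x) - f(y).
    This bounds the square of |f(x) - f(y)| by |f(x) - f(y)| times [osc_bound], and one factor is
    cancelled. *)
Lemma tp_osc d s a b N delta M x y :
  (forall j, (j < d)%nat -> (4 * 2 ^ s j <= N)%nat) ->
  (forall x y, near d delta x y -> tp_abs d s a b x <= M y) ->
  near d delta x y ->
  sqrt (Rsqr (tp_re d s a b x - tp_re d s a b y) + Rsqr (tp_im d s a b x - tp_im d s a b y))
    <= osc_bound d s N delta M y.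
Proof.
  intros HN HM Hxy.
  set (c1 := tp_re d s a b x - tp_re d s a b y).
  set (c2 := tp_im d s a b x - tp_im d s a b y).
  set (c := sqrt (Rsqr c1 + Rsqr c2)).
  assert (Hc : 0 <= c) by apply sqrt_pos.
  assert (Hc2 : c * c = c1 * c1 + c2 * c2).
  { unfold c; rewrite sqrt_sqrt; [reflexivity|apply Rplus_le_le_0_compat; apply Rle_0_sqr]. }
  pose (h := fun j => x j - y j).
  pose (p := fun t => fun j => y j + t * h j).
  pose (g := fun (F : (nat -> R) -> R) t => lsum (seq 0 d) (fun j => h j * lsum (seq 0 N) (fun k =>
       bern (2 ^ s j) N k * F (upd (p t) j (p t j - node N k))))).
  destruct (MVT_cor2 (fun t => c1 * tp_re d s a b (p t) + c2 * tp_re d s b (fun k => - a k) (p t))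
    (fun t => c1 * g (tp_re d s a b) t + c2 * g (tp_re d s b (fun k => - a k)) t) 0 1 ltac:(lra))
    as (t & Ht & Ht01).
  { intros t _.
    apply (derivable_pt_lim_plus (fun t => c1 * tp_re d s a b (p t))
      (fun t => c2 * tp_re d s b (fun k => - a k) (p t))).
    - apply (derivable_pt_lim_scal (fun t => tp_re d s a b (p t))).
      apply (tp_re_derivative d s a b N y h t HN).
    - apply (derivable_pt_lim_scal (fun t => tp_re d s b (fun k => - a k) (p t))).
      apply (tp_re_derivative d s b (fun k => - a k) N y h t HN). }
  assert (P1 : p 1 = x) by (apply functional_extensionality; intros j; unfold p, h; ring).
  assert (P0 : p 0 = y) by (apply functional_extensionality; intros j; unfold p, h; ring).
  rewrite P0, P1, <- !tp_im_re in Ht.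
  assert (Hmain : c * c <= c * osc_bound d s N delta M y).
  { rewrite Hc2.
    replace (c1 * c1 + c2 * c2) with
      (c1 * g (tp_re d s a b) t + c2 * g (tp_re d s b (fun k => - a k)) t)
      by (unfold c1, c2 in *; lra).
    unfold g, osc_bound. rewrite <- !lsum_scal, <- lsum_plus.
    apply lsum_le; intros j Hj%in_seq.
    rewrite <- !lsum_scal, <- lsum_plus.
    apply lsum_le; intros k _.
    set (z := upd (p t) j (p t j - node N k)).
    set (w := upd y j (y j - node N k)).
    (* The same translation is applied to the intermediate point and to [y], so [z] and [w] still
       differ by [t * (x - y)] and are near each other. *)
    assert (Hz : tp_abs d s a b z <= M w).
    { apply HM. intros i Hi. specialize (Hxy i Hi).
      replace (z i - w i) with (t * (x i - y i)).
      - rewrite Rabs_mult, (Rabs_pos_eq t) by lra.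
        pose proof (Rabs_pos (x i - y i)). nra.
      - unfold z, w. destruct (Nat.eq_dec i j) as [->|Hij].
        + rewrite !upd_same. unfold p, h; ring.
        + rewrite !upd_other by exact Hij. unfold p, h; ring. }
    rewrite <- tp_im_re.
    set (u1 := tp_re d s a b z); set (u2 := tp_im d s a b z).
    set (be := bern (2 ^ s j) N k).
    replace (c1 * (h j * (be * u1)) + c2 * (h j * (be * u2)))
      with (h j * be * (c1 * u1 + c2 * u2)) by ring.
    assert (HA : Rabs (c1 * u1 + c2 * u2) <= c * M w).
    { apply Rle_trans with (c * tp_abs d s a b z); [|apply Rmult_le_compat_l; assumption].
      apply Rabs_le. split.
      - pose proof (sqrt_cauchy (- c1) (- c2) u1 u2) as Q.
        rewrite <- !Rsqr_neg in Q.
        change (- c1 * u1 + - c2 * u2 <= c * tp_abs d s a b z) in Q. lra.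
      - apply (sqrt_cauchy c1 c2 u1 u2). }
    eapply Rle_trans; [apply Rle_abs|]. rewrite !Rabs_mult.
    replace (c * (delta j * Rabs be * M w)) with (delta j * Rabs be * (c * M w)) by ring.
    assert (Rabs (h j) <= delta j) by (apply Hxy; lia).
    apply Rmult_le_compat; [| |apply Rmult_le_compat_r|exact HA].
    - apply Rmult_le_pos; apply Rabs_pos.
    - apply Rabs_pos.
    - apply Rabs_pos.
    - assumption. }
  (* When [c = 0] nothing can be cancelled, and the claim is that the bound is nonnegative. *)
  destruct (Rle_lt_or_eq_dec 0 c Hc) as [Hpos|Hz].
  - apply Rmult_le_reg_l with c; assumption.
  - rewrite <- Hz. unfold osc_bound.
    apply lsum_nonneg; intros j Hj%in_seq. apply lsum_nonneg; intros k _.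
    assert (0 <= delta j).
    { eapply Rle_trans; [apply Rabs_pos|apply Hxy; lia]. }
    apply Rmult_le_pos; [apply Rmult_le_pos; [assumption|apply Rabs_pos]|].
    eapply Rle_trans; [apply tp_abs_nonneg|apply HM].
    intros i Hi.
    replace (_ - _) with 0 by (unfold Rminus; symmetry; apply Rplus_opp_r).
    rewrite Rabs_R0. eapply Rle_trans; [apply Rabs_pos|apply Hxy; exact Hi].
Qed.

Lemma tp_abs_osc d s a b N delta M x y :
  (forall j, (j < d)%nat -> (4 * 2 ^ s j <= N)%nat) ->
  (forall x y, near d delta x y -> tp_abs d s a b x <= M y) ->
  near d delta x y ->
  tp_abs d s a b x <= tp_abs d s a b y + osc_bound d s N delta M y /\
  tp_abs d s a b y <= tp_abs d s a b x + osc_bound d s N delta M y.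
Proof.
  intros HN HM Hxy. pose proof (tp_osc d s a b N delta M x y HN HM Hxy) as H.
  unfold tp_abs.
  pose proof (sqrt_Rsqr_plus_triang (tp_re d s a b x) (tp_im d s a b x)
    (tp_re d s a b y) (tp_im d s a b y)) as H1.
  pose proof (sqrt_Rsqr_plus_triang (tp_re d s a b y) (tp_im d s a b y)
    (tp_re d s a b x) (tp_im d s a b x)) as H2.
  rewrite (Rsqr_neg (tp_re d s a b y - _)), (Rsqr_neg (tp_im d s a b y - _)),
    !Ropp_minus_distr in H2.
  lra.
Qed.

(** * Powers and Jensen's inequality *)

Lemma rpow_0 q : rpow 0 q = 0.
Proof. unfold rpow. destruct (Rle_dec 0 0); lra. Qed.

Lemma rpow_pos_eq a q : 0 < a -> rpow a q = Rpower a q.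
Proof. intros H. unfold rpow. destruct (Rle_dec a 0); lra. Qed.

Lemma rpow_pos a q : 0 < a -> 0 < rpow a q.
Proof. intros H. rewrite rpow_pos_eq by exact H. apply exp_pos. Qed.

Lemma rpow_nonneg a q : 0 <= rpow a q.
Proof. unfold rpow. destruct (Rle_dec a 0); [lra|left; apply exp_pos]. Qed.

Lemma rpow_le a b q : 0 <= q -> a <= b -> rpow a q <= rpow b q.
Proof.
  intros Hq H. destruct (Rle_dec a 0) as [Ha|Ha].
  - unfold rpow at 1. destruct (Rle_dec a 0); [apply rpow_nonneg|contradiction].
  - rewrite !rpow_pos_eq by lra. apply Rle_Rpower_l; lra.
Qed.

Lemma rpow_mult a b q : 0 <= a -> 0 <= b -> rpow (a * b) q = rpow a q * rpow b q.
Proof.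
  intros [Ha| <-] [Hb| <-]; rewrite ?Rmult_0_l, ?Rmult_0_r, ?rpow_0, ?Rmult_0_l, ?Rmult_0_r;
    try reflexivity.
  assert (0 < a * b) by (apply Rmult_lt_0_compat; assumption).
  rewrite !rpow_pos_eq by assumption. symmetry; apply Rpower_mult_distr; assumption.
Qed.

(** The tangent line of the power at 1. If its value [u] is positive, weighted AM-GM gives that the
    power of [u] with exponent [/ q] is at most [t], and raising to the power [q] finishes. *)
Lemma Rpower_bernoulli t q : 1 <= q -> 0 < t -> 1 + q * (t - 1) <= Rpower t q.
Proof.
  intros Hq Ht. set (u := 1 + q * (t - 1)).
  destruct (Rle_dec u 0) as [Hu|Hu].
  { pose proof (exp_pos (q * ln t)). unfold Rpower. lra. }
  apply Rnot_le_lt in Hu.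
  set (lam := / q).
  assert (Hlam : 0 < lam <= 1).
  { unfold lam; split; [apply Rinv_0_lt_compat; lra|].
    rewrite <- Rinv_1. apply Rinv_le_contravar; lra. }
  (* Weighted AM-GM for 1 and u, via exp x >= 1 + x. *)
  assert (HG : exp (lam * ln u) <= t).
  { set (G := exp (lam * ln u)). assert (G0 : 0 < G) by apply exp_pos.
    assert (H1 : G * (1 - lam * ln u) <= 1).
    { replace 1 with (G * exp (- (lam * ln u))) at 2
        by (unfold G; rewrite <- exp_plus, Rplus_opp_r; apply exp_0).
      apply Rmult_le_compat_l; [lra|]. pose proof (exp_ineq1_le (- (lam * ln u))). lra. }
    assert (H2 : G * (1 + (ln u - lam * ln u)) <= u).
    { replace u with (G * exp (ln u - lam * ln u)) at 3
        by (unfold G; rewrite <- exp_plus; replace (_ + _) with (ln u) by ring;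
            apply exp_ln; exact Hu).
      apply Rmult_le_compat_l; [lra|]. apply exp_ineq1_le. }
    replace t with ((1 - lam) * 1 + lam * u).
    - nra.
    - unfold u, lam. field. lra. }
  assert (H : lam * ln u <= ln t).
  { rewrite <- (ln_exp (lam * ln u)).
    destruct HG as [HG| ->]; [left; apply ln_increasing; [apply exp_pos|exact HG]|right; reflexivity]. }
  unfold Rpower. rewrite <- (exp_ln u) by exact Hu.
  assert (Hle : ln u <= q * ln t).
  { replace (ln u) with (q * (lam * ln u)) by (unfold lam; field; lra).
    apply Rmult_le_compat_l; lra. }
  destruct Hle as [Hle| ->]; [left; apply exp_increasing; exact Hle|right; reflexivity].
Qed.

Lemma rpow_tangent a mu q : 1 <= q -> 0 <= a -> 0 < mu ->
  rpow mu q * (1 + q * (a / mu - 1)) <= rpow a q.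
Proof.
  intros Hq [Ha| <-] Hmu.
  - assert (0 < a / mu) by (apply Rdiv_lt_0_compat; assumption).
    replace a with (mu * (a / mu)) at 2 by (field; lra).
    rewrite rpow_mult, (rpow_pos_eq (a / mu)) by lra.
    apply Rmult_le_compat_l; [apply rpow_nonneg|apply Rpower_bernoulli; assumption].
  - rewrite rpow_0. pose proof (rpow_pos mu q Hmu).
    unfold Rdiv; rewrite Rmult_0_l. nra.
Qed.

(** The tangent inequality at [mu = S / w] is summed against the weights. A total weight below [w]
    suffices, because it is multiplied by the nonpositive factor [1 - q]. *)
Lemma lsum_jensen {A} (l : list A) (W f : A -> R) w q :
  1 <= q -> 0 < w -> (forall a, In a l -> 0 <= W a) -> (forall a, In a l -> 0 <= f a) ->
  lsum l W <= w ->
  rpow (lsum l (fun a => W a * f a)) q <= rpow w q / w * lsum l (fun a => W a * rpow (f a) q).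
Proof.
  intros Hq Hw HW Hf Hl. set (S := lsum l (fun a => W a * f a)).
  assert (HS : 0 <= S) by (apply lsum_nonneg; intros a Ha; apply Rmult_le_pos; auto).
  assert (Hww : 0 < rpow w q / w) by (apply Rdiv_lt_0_compat; [apply rpow_pos|]; exact Hw).
  destruct HS as [HS| <-].
  2: { rewrite rpow_0. apply Rmult_le_pos; [lra|].
       apply lsum_nonneg; intros a Ha; apply Rmult_le_pos; [auto|apply rpow_nonneg]. }
  set (mu := S / w). assert (Hmu : 0 < mu) by (apply Rdiv_lt_0_compat; assumption).
  assert (HE : S = w * mu) by (unfold mu; field; lra).
  rewrite HE, rpow_mult by lra.
  replace (rpow w q * rpow mu q) with (rpow w q / w * (w * rpow mu q)) by (field; lra).
  apply Rmult_le_compat_l; [lra|].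
  apply Rle_trans with (lsum l (fun a => (rpow mu q * (1 - q)) * W a
    + (rpow mu q * (q / mu)) * (W a * f a))).
  - rewrite lsum_plus, !lsum_scal. fold S. rewrite HE at 1.
    replace (rpow mu q * (q / mu) * (w * mu)) with (rpow mu q * (q * w)) by (field; lra).
    rewrite Rmult_assoc, <- Rmult_plus_distr_l, Rmult_comm.
    apply Rmult_le_compat_l; [apply rpow_nonneg|]. nra.
  - apply lsum_le; intros a Ha.
    replace (rpow mu q * (1 - q) * W a + rpow mu q * (q / mu) * (W a * f a))
      with (W a * (rpow mu q * (1 + q * (f a / mu - 1)))) by (field; lra).
    apply Rmult_le_compat_l; [auto|]. apply rpow_tangent; auto.
Qed.

(** Jensen for two unit weights, of total [w = 2]. *)
Lemma rpow_plus_le a b q : 1 <= q -> 0 <= a -> 0 <= b ->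
  rpow (a + b) q <= rpow 2 q / 2 * (rpow a q + rpow b q).
Proof.
  intros Hq Ha Hb.
  pose proof (lsum_jensen (a :: b :: nil) (fun _ => 1) (fun x => x) 2 q Hq ltac:(lra)) as J.
  simpl in J. rewrite !Rmult_1_l, !Rplus_0_r in J. apply J.
  - intros; lra.
  - intros x [<-|[<-|[]]]; assumption.
  - lra.
Qed.

Lemma rpow_2_ge q : 1 <= q -> 2 <= rpow 2 q.
Proof.
  intros Hq. rewrite rpow_pos_eq by lra. rewrite <- (Rpower_1 2) at 1 by lra.
  apply Rle_Rpower; lra.
Qed.

(** * The uniform grid *)

Fixpoint gridlist (d N : nat) : list (nat -> R) :=
  match d with
  | O => (fun _ => 0) :: nil
  | S d' => flat_map (fun x => map (fun t => upd x d' (node N t)) (seq 0 N)) (gridlist d' N)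
  end.

Lemma grid_sum_lsum d N g : (1 <= N)%nat -> grid_sum d N g = lsum (gridlist d N) g.
Proof.
  intros HN. revert g; induction d as [|d IH]; intros g; [simpl; lra|].
  cbn [grid_sum gridlist]. rewrite IH, lsum_flat_map. apply lsum_ext; intros x.
  rewrite lsum_map, sum_f_R0_lsum. now replace (S (N - 1)) with N by lia.
Qed.

(** Modulo the period, translation by a node permutes the grid. *)
Lemma lsum_gridlist_shift d N j k (Phi : (nat -> R) -> R) :
  (j < d)%nat -> (k < N)%nat ->
  (forall x, Phi (upd x j (x j + 2 * PI)) = Phi x) ->
  lsum (gridlist d N) (fun y => Phi (upd y j (y j - node N k))) = lsum (gridlist d N) Phi.
Proof.
  intros Hj Hk. revert Phi; induction d as [|d IH]; intros Phi HPhi; [lia|].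
  assert (HN : INR N <> 0) by (apply not_0_INR; lia).
  cbn [gridlist]. rewrite !lsum_flat_map.
  destruct (Nat.eq_dec j d) as [->|Hjd].
  - apply lsum_ext; intros y. rewrite !lsum_map.
    assert (Hper : forall z, Phi (upd y d (z + 2 * PI)) = Phi (upd y d z)).
    { intros z. rewrite <- (HPhi (upd y d z)), upd_same, upd_upd. reflexivity. }
    (* The backward shift by [k] becomes a forward shift by [N - k], which stays in the naturals and
       differs by one full period. *)
    rewrite <- (lsum_periodic_affine 1 N (N - k) (fun t => Phi (upd y d (node N t)))).
    + apply lsum_ext; intros t. rewrite upd_same, upd_upd.
      rewrite <- (Hper (node N t - node N k)).
      replace (node N (N - k + 1 * t)) with (node N t - node N k + 2 * PI); [reflexivity|].
      unfold node. rewrite Nat.mul_1_l, plus_INR, minus_INR by lia. field. exact HN.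
    + lia.
    + reflexivity.
    + intros l. rewrite <- (Hper (node N l)).
      replace (node N (l + N)) with (node N l + 2 * PI); [reflexivity|].
      unfold node. rewrite plus_INR. field. exact HN.
  - rewrite <- (IH ltac:(lia) (fun y => lsum (map (fun t => upd y d (node N t)) (seq 0 N)) Phi)).
    + apply lsum_ext; intros y. rewrite !lsum_map. apply lsum_ext; intros t.
      rewrite upd_other by exact Hjd. rewrite upd_comm by auto. reflexivity.
    + intros x. rewrite !lsum_map. apply lsum_ext; intros t.
      rewrite <- (HPhi (upd x d (node N t))), upd_other, upd_comm by auto. reflexivity.
Qed.

Lemma osc_bound_weight d s N delta :
  (forall j, (j < d)%nat -> (4 * 2 ^ s j <= N)%nat) ->
  (forall j, (j < d)%nat -> 0 <= delta j) ->
  lsum (seq 0 d) (fun j => lsum (seq 0 N) (fun k => delta j * Rabs (bern (2 ^ s j) N k)))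
    <= lsum (seq 0 d) (fun j => delta j * (2 * 2 ^ s j)).
Proof.
  intros HN Hd. apply lsum_le; intros j Hj%in_seq. rewrite lsum_scal.
  apply Rmult_le_compat_l; [apply Hd; lia|].
  eapply Rle_trans; [apply bern_mass|].
  - pose proof (Nat.pow_nonzero 2 (s j)); lia.
  - apply HN; lia.
  - rewrite pow_INR. right; reflexivity.
Qed.

(** Jensen over the pairs (coordinate, translation) moves the power inside; after exchanging the
    sums, every translate of [M] has the same grid sum. *)
Lemma lsum_rpow_osc_bound d s N delta M q w :
  1 <= q -> 0 < w ->
  (forall j, (j < d)%nat -> (4 * 2 ^ s j <= N)%nat) ->
  (forall j, (j < d)%nat -> 0 <= delta j) ->
  lsum (seq 0 d) (fun j => delta j * (2 * 2 ^ s j)) <= w ->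
  (forall y, 0 <= M y) ->
  (forall y j, (j < d)%nat -> M (upd y j (y j + 2 * PI)) = M y) ->
  lsum (gridlist d N) (fun y => rpow (osc_bound d s N delta M y) q)
    <= rpow w q * lsum (gridlist d N) (fun y => rpow (M y) q).
Proof.
  intros Hq Hw HN Hd Hdw HM HMper.
  pose (W := fun p : nat * nat => delta (fst p) * Rabs (bern (2 ^ s (fst p)) N (snd p))).
  assert (HW : forall p, In p (list_prod (seq 0 d) (seq 0 N)) -> 0 <= W p).
  { intros [j k] [Hj%in_seq _]%in_prod_iff.
    apply Rmult_le_pos; [apply Hd; simpl; lia|apply Rabs_pos]. }
  assert (Hsum : lsum (list_prod (seq 0 d) (seq 0 N)) W <= w).
  { rewrite lsum_list_prod. eapply Rle_trans; [apply (osc_bound_weight d s N delta HN Hd)|exact Hdw]. }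
  pose (sh := fun (y : nat -> R) (p : nat * nat) => upd y (fst p) (y (fst p) - node N (snd p))).
  set (S := lsum (gridlist d N) (fun y => rpow (M y) q)).
  assert (HS : 0 <= S) by (apply lsum_nonneg; intros; apply rpow_nonneg).
  apply Rle_trans with (lsum (gridlist d N) (fun y => rpow w q / w *
    lsum (list_prod (seq 0 d) (seq 0 N)) (fun p => W p * rpow (M (sh y p)) q))).
  - apply lsum_le; intros y _.
    replace (osc_bound d s N delta M y)
      with (lsum (list_prod (seq 0 d) (seq 0 N)) (fun p => W p * M (sh y p)))
      by (rewrite lsum_list_prod; reflexivity).
    apply lsum_jensen; auto.
  - rewrite lsum_scal, lsum_swap.
    rewrite (lsum_ext_in _ _ (fun p => W p * S)).
    + rewrite lsum_scal_r.
      replace (rpow w q * S) with (rpow w q / w * (w * S)) by (field; lra).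
      apply Rmult_le_compat_l.
      * left; apply Rdiv_lt_0_compat; [apply rpow_pos|]; exact Hw.
      * apply Rmult_le_compat_r; assumption.
    + intros [j k] [Hj%in_seq Hk%in_seq]%in_prod_iff. rewrite lsum_scal. f_equal.
      apply (lsum_gridlist_shift d N j k (fun y => rpow (M y) q)); [lia|lia|].
      intros x. rewrite HMper by lia. reflexivity.
Qed.

(** * Local suprema and comparison with the grid *)

Lemma near_refl d delta y : (forall j, (j < d)%nat -> 0 <= delta j) -> near d delta y y.
Proof. intros H j Hj. unfold Rminus. rewrite Rplus_opp_r, Rabs_R0. apply H, Hj. Qed.

Lemma near_sup d delta (F : (nat -> R) -> R) :
  (exists B, forall x, F x <= B) -> (forall j, (j < d)%nat -> 0 <= delta j) ->
  exists M : (nat -> R) -> R,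
    (forall x y, near d delta x y -> F x <= M y) /\
    (forall y B, (forall x, near d delta x y -> F x <= B) -> M y <= B).
Proof.
  intros [B HB] Hd.
  assert (Hb : forall y, bound (fun v => exists x, near d delta x y /\ v = F x)).
  { intros y. exists B. intros v (x & _ & ->). apply HB. }
  assert (Hne : forall y, exists v, exists x, near d delta x y /\ v = F x).
  { intros y. exists (F y), y. split; [apply near_refl, Hd|reflexivity]. }
  exists (fun y => proj1_sig (completeness _ (Hb y) (Hne y))). split.
  - intros x y Hxy. destruct (completeness _ (Hb y) (Hne y)) as [m [Hm Hm']]. simpl.
    apply Hm. exists x. auto.
  - intros y C HC. destruct (completeness _ (Hb y) (Hne y)) as [m [Hm' Hm]]. simpl.
    apply Hm. intros v (x & Hx & ->). apply HC, Hx.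
Qed.

(* With [M] the local supremum of [|f|]: since [M <= |f| + osc_bound M], and the
   [l_q] norm of [osc_bound M] is at most a quarter of that of [M], the norm of [M]
   is controlled by that of [f]. *)
Lemma tp_grid_osc d s a b N delta q :
  1 <= q ->
  (forall j, (j < d)%nat -> (4 * 2 ^ s j <= N)%nat) ->
  (forall j, (j < d)%nat -> 0 <= delta j) ->
  lsum (seq 0 d) (fun j => delta j * (2 * 2 ^ s j)) <= / 4 ->
  exists T : (nat -> R) -> R,
    (forall y, 0 <= T y) /\
    (forall x y, near d delta x y ->
      tp_abs d s a b x <= tp_abs d s a b y + T y /\
      tp_abs d s a b y <= tp_abs d s a b x + T y) /\
    rpow 2 q * lsum (gridlist d N) (fun y => rpow (T y) q)
      <= lsum (gridlist d N) (fun y => rpow (tp_abs d s a b y) q).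
Proof.
  intros Hq HN Hd Hw.
  destruct (near_sup d delta (tp_abs d s a b) (tp_abs_bounded d s a b) Hd) as (M & HM1 & HM2).
  assert (HM0 : forall y, 0 <= M y).
  { intros y. eapply Rle_trans; [apply tp_abs_nonneg|apply (HM1 y), near_refl, Hd]. }
  assert (HT0 : forall y, 0 <= osc_bound d s N delta M y).
  { intros y. apply lsum_nonneg; intros j Hj%in_seq. apply lsum_nonneg; intros k _.
    apply Rmult_le_pos; [|apply HM0].
    apply Rmult_le_pos; [apply Hd; lia|apply Rabs_pos]. }
  (* [M] inherits the period of |f|: the one-sided inequality [W] is used for the shifts by [2 * PI]
     and by its negative. *)
  assert (HMper : forall y j, (j < d)%nat -> M (upd y j (y j + 2 * PI)) = M y).
  { assert (W : forall y j e, (j < d)%nat ->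
      (forall x, tp_abs d s a b (upd x j (x j + e)) = tp_abs d s a b x) ->
      M (upd y j (y j - e)) <= M y).
    { intros y j e Hj He. apply HM2. intros x Hx. rewrite <- He. apply HM1.
      intros i Hi. specialize (Hx i Hi). destruct (Nat.eq_dec i j) as [->|Hij].
      - rewrite upd_same in Hx |- *. replace (x j + e - y j) with (x j - (y j - e)) by ring. exact Hx.
      - rewrite upd_other in Hx |- * by exact Hij. exact Hx. }
    intros y j Hj. apply Rle_antisym.
    - replace (y j + 2 * PI) with (y j - - (2 * PI)) by ring. apply W; [exact Hj|].
      intros x. rewrite <- (tp_abs_periodic d s a b (upd x j (x j + - (2 * PI))) j).
      rewrite upd_same, upd_upd. f_equal. apply functional_extensionality; intros i.
      unfold upd. destruct (Nat.eqb_spec i j) as [->|_]; [ring|reflexivity].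
    - replace y with (upd (upd y j (y j + 2 * PI)) j (upd y j (y j + 2 * PI) j - 2 * PI)) at 1.
      + apply W; [exact Hj|]. intros x. apply tp_abs_periodic.
      + rewrite upd_same, upd_upd. apply functional_extensionality; intros i.
        unfold upd. destruct (Nat.eqb_spec i j) as [->|_]; [ring|reflexivity]. }
  exists (osc_bound d s N delta M). split; [exact HT0|]. split.
  { intros x y Hxy. apply tp_abs_osc; assumption. }
  set (F := lsum (gridlist d N) (fun y => rpow (tp_abs d s a b y) q)).
  set (S := lsum (gridlist d N) (fun y => rpow (M y) q)).
  set (O := lsum (gridlist d N) (fun y => rpow (osc_bound d s N delta M y) q)).
  set (K := rpow 2 q). assert (HK : 2 <= K) by apply rpow_2_ge, Hq.
  assert (HO : O <= rpow (/ 4) q * S) by (apply lsum_rpow_osc_bound; auto; lra).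
  assert (HS : S <= K / 2 * (F + O)).
  { unfold F, O. rewrite <- lsum_plus, <- lsum_scal. apply lsum_le; intros y _.
    eapply Rle_trans; [apply rpow_le; [lra|apply HM2]|].
    - intros x Hx. apply (tp_abs_osc d s a b N delta M x y HN HM1 Hx).
    - apply rpow_plus_le; [exact Hq|apply tp_abs_nonneg|apply HT0]. }
  (* This is why the threshold is 1/4: the factor gained from it pays for two uses of [K], uniformly
     in [q]. *)
  assert (H4 : K * K * rpow (/ 4) q = 1).
  { unfold K. rewrite <- !rpow_mult by lra. replace (2 * 2 * / 4) with 1 by field.
    rewrite rpow_pos_eq by lra. unfold Rpower. rewrite ln_1, Rmult_0_r. apply exp_0. }
  assert (HO0 : 0 <= O) by (apply lsum_nonneg; intros; apply rpow_nonneg).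
  assert (HF0 : 0 <= F) by (apply lsum_nonneg; intros; apply rpow_nonneg).
  assert (HO' : K * K * O <= S).
  { apply Rle_trans with (K * K * (rpow (/ 4) q * S)).
    - apply Rmult_le_compat_l; [nra|exact HO].
    - rewrite <- Rmult_assoc, H4. lra. }
  (* From [K * K * O <= S <= K / 2 * (F + O)]; since [K >= 2], the term [O] on the right is then
     absorbed. *)
  assert (K * O <= (F + O) / 2).
  { apply Rmult_le_reg_l with K; lra. }
  nra.
Qed.

(** The weights [chi] couple the sample points with the grid: each grid point spreads mass 1 over
    the samples, each sample receives mass [kappa], and mass only joins nearby points. Both sums are
    thereby written over the same pairs and compared termwise. *)
Lemma tp_grid_compare d s a b N delta q (L : list nat) (X : nat -> nat -> R)
    (chi : nat -> (nat -> R) -> R) kappa :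
  1 <= q ->
  (forall j, (j < d)%nat -> (4 * 2 ^ s j <= N)%nat) ->
  (forall j, (j < d)%nat -> 0 <= delta j) ->
  lsum (seq 0 d) (fun j => delta j * (2 * 2 ^ s j)) <= / 4 ->
  (forall r y, 0 <= chi r y) ->
  (forall r y, In r L -> In y (gridlist d N) -> chi r y <> 0 -> near d delta (X r) y) ->
  (forall y, In y (gridlist d N) -> lsum L (fun r => chi r y) = 1) ->
  (forall r, In r L -> lsum (gridlist d N) (chi r) = kappa) ->
  let F := lsum (gridlist d N) (fun y => rpow (tp_abs d s a b y) q) in
  let Y := kappa * lsum L (fun r => rpow (tp_abs d s a b (X r)) q) in
  Y <= rpow 2 q * F /\ F <= rpow 2 q * Y.
Proof.
  intros Hq HN Hd Hw Hchi Hnear Hone Hkap F Y.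
  destruct (tp_grid_osc d s a b N delta q Hq HN Hd Hw) as (T & HT0 & HT & HO).
  fold F in HO. set (O := lsum (gridlist d N) (fun y => rpow (T y) q)) in HO.
  set (K := rpow 2 q) in *. assert (HK : 2 <= K) by apply rpow_2_ge, Hq.
  set (G := gridlist d N) in *.
  assert (EY : Y = lsum G (fun y => lsum L (fun r => chi r y * rpow (tp_abs d s a b (X r)) q))).
  { unfold Y. rewrite lsum_swap, <- lsum_scal. apply lsum_ext_in; intros r Hr.
    rewrite lsum_scal_r. rewrite <- (Hkap r Hr). reflexivity. }
  assert (E1 : forall g, lsum G g = lsum G (fun y => lsum L (fun r => chi r y * g y))).
  { intros g. apply lsum_ext_in; intros y Hy. rewrite lsum_scal_r, Hone by exact Hy. ring. }
  assert (HYF : Y <= K / 2 * (F + O)).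
  { rewrite EY. unfold F, O. rewrite <- lsum_plus, <- lsum_scal, (E1 (fun y => K / 2 * _)).
    apply lsum_le; intros y Hy. apply lsum_le; intros r Hr.
    destruct (Req_dec (chi r y) 0) as [->|Hc]; [rewrite !Rmult_0_l; lra|].
    apply Rmult_le_compat_l; [apply Hchi|].
    destruct (HT _ _ (Hnear r y Hr Hy Hc)) as [H _].
    eapply Rle_trans; [apply rpow_le; [lra|exact H]|].
    apply rpow_plus_le; [exact Hq|apply tp_abs_nonneg|apply HT0]. }
  assert (HFY : F <= K / 2 * (Y + O)).
  { unfold O. rewrite EY, (E1 (fun y => rpow (T y) q)), <- lsum_plus, <- lsum_scal.
    unfold F. rewrite E1. apply lsum_le; intros y Hy.
    rewrite <- lsum_plus, <- lsum_scal. apply lsum_le; intros r Hr.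
    destruct (Req_dec (chi r y) 0) as [->|Hc]; [rewrite !Rmult_0_l; lra|].
    rewrite <- Rmult_plus_distr_l, <- Rmult_assoc, (Rmult_comm (K / 2)), Rmult_assoc.
    apply Rmult_le_compat_l; [apply Hchi|].
    destruct (HT _ _ (Hnear r y Hr Hy Hc)) as [_ H].
    eapply Rle_trans; [apply rpow_le; [lra|exact H]|].
    apply rpow_plus_le; [exact Hq|apply tp_abs_nonneg|apply HT0]. }
  assert (HF0 : 0 <= F) by (apply lsum_nonneg; intros; apply rpow_nonneg).
  (* By [K * O <= F], the error in [HYF] is at most [F / 2], and the one in [HFY] is absorbed into
     the left side. *)
  split; nra.
Qed.

(** * Halton points *)

Fixpoint nprod (d : nat) (g : nat -> nat) : nat :=
  match d with O => 1%nat | S d' => (nprod d' g * g d')%nat end.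

Fixpoint rprod (d : nat) (g : nat -> R) : R :=
  match d with O => 1 | S d' => rprod d' g * g d' end.

Lemma nprod_pos d g : (forall j, (j < d)%nat -> (0 < g j)%nat) -> (0 < nprod d g)%nat.
Proof.
  induction d as [|d IH]; intros H; simpl; [lia|].
  apply Nat.mul_pos_pos; [apply IH; intros; apply H|apply H]; lia.
Qed.

Lemma nprod_divide d g j : (j < d)%nat -> Nat.divide (g j) (nprod d g).
Proof.
  induction d as [|d IH]; intros Hj; [lia|]. simpl.
  destruct (Nat.eq_dec j d) as [->|Hjd].
  - apply Nat.divide_factor_r.
  - apply Nat.divide_mul_l, IH. lia.
Qed.

Lemma nprod_le d g h :
  (forall j, (j < d)%nat -> (g j <= h j)%nat) -> (nprod d g <= nprod d h)%nat.
Proof.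
  induction d as [|d IH]; intros H; simpl; [lia|].
  apply Nat.mul_le_mono; [apply IH; intros; apply H|apply H]; lia.
Qed.

Lemma rprod_ext d g h : (forall j, (j < d)%nat -> g j = h j) -> rprod d g = rprod d h.
Proof.
  induction d as [|d IH]; intros H; simpl; [reflexivity|].
  rewrite IH, H by (auto with arith). reflexivity.
Qed.

Lemma rprod_nonneg d g : (forall j, 0 <= g j) -> 0 <= rprod d g.
Proof. intros H. induction d; simpl; [lra|apply Rmult_le_pos; auto]. Qed.

Lemma rprod_neq_0 d g : rprod d g <> 0 -> forall j, (j < d)%nat -> g j <> 0.
Proof.
  induction d as [|d IH]; intros H j Hj E; [lia|]. simpl in H.
  destruct (Nat.eq_dec j d) as [->|Hjd].
  - apply H. rewrite E; ring.
  - apply (IH (fun E' => H ltac:(rewrite E'; ring)) j ltac:(lia) E).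
Qed.

(** * Pairwise coprime bases *)

Lemma nat_gcd_mul_1 a b c : Nat.gcd a c = 1%nat -> Nat.gcd b c = 1%nat -> Nat.gcd (a * b) c = 1%nat.
Proof.
  intros Ha Hb. set (g := Nat.gcd (a * b) c).
  assert (Hga : Nat.gcd g a = 1%nat).
  { apply Nat.divide_1_r. rewrite <- Ha. apply Nat.gcd_greatest.
    - apply Nat.gcd_divide_r.
    - eapply Nat.divide_trans; [apply Nat.gcd_divide_l|apply Nat.gcd_divide_r]. }
  assert (Hgb : Nat.divide g b) by (apply (Nat.gauss g a b); [apply Nat.gcd_divide_l|exact Hga]).
  apply Nat.divide_1_r. rewrite <- Hb.
  apply Nat.gcd_greatest; [exact Hgb|apply Nat.gcd_divide_r].
Qed.

Lemma nat_gcd_pow_1 a b e : Nat.gcd a b = 1%nat -> Nat.gcd (a ^ e) b = 1%nat.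
Proof.
  intros H. induction e as [|e IH]; [apply Nat.divide_1_r, Nat.gcd_divide_l|]. simpl. apply nat_gcd_mul_1; assumption.
Qed.

(* Euclid's construction of pairwise coprime numbers. *)
Fixpoint euclid (j : nat) : nat :=
  match j with O => 1%nat | S j' => (euclid j' * S (euclid j'))%nat end.

(** Sylvester's sequence 2, 3, 7, 43, ...; [euclid j] is the product of the bases before
    [base j]. *)
Definition base (j : nat) : nat := S (euclid j).

Lemma euclid_pos j : (0 < euclid j)%nat.
Proof. induction j as [|j IH]; simpl; [lia|]. apply Nat.mul_pos_pos; lia. Qed.

Lemma base_ge_2 j : (2 <= base j)%nat.
Proof. pose proof (euclid_pos j). unfold base; lia. Qed.

Lemma base_divide_euclid i j : (i < j)%nat -> Nat.divide (base i) (euclid j).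
Proof.
  induction j as [|j IH]; intros H; [lia|]. simpl.
  destruct (Nat.eq_dec i j) as [->|Hij]; [apply Nat.divide_factor_r|].
  apply Nat.divide_mul_l, IH. lia.
Qed.

Lemma base_coprime i j : (i < j)%nat -> Nat.gcd (base i) (base j) = 1%nat.
Proof.
  intros H. destruct (base_divide_euclid i j H) as [k Hk].
  apply Nat.divide_1_r.
  assert (H1 : Nat.divide (Nat.gcd (base i) (base j)) (euclid j)).
  { rewrite Hk. apply Nat.divide_mul_r, Nat.gcd_divide_l. }
  assert (H2 : Nat.divide (Nat.gcd (base i) (base j)) (euclid j + 1)).
  { rewrite Nat.add_1_r. apply Nat.gcd_divide_r. }
  apply (Nat.divide_add_cancel_r _ (euclid j) 1 H1 H2).
Qed.

Lemma nprod_base_coprime d e (c : nat -> nat) : (d <= e)%nat ->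
  Nat.gcd (nprod d (fun j => base j ^ c j)%nat) (base e ^ c e) = 1%nat.
Proof.
  induction d as [|d IH]; intros H; [apply Nat.divide_1_r, Nat.gcd_divide_l|]. simpl.
  apply nat_gcd_mul_1; [apply IH; lia|].
  apply nat_gcd_pow_1. rewrite Nat.gcd_comm. apply nat_gcd_pow_1.
  rewrite Nat.gcd_comm. apply base_coprime. lia.
Qed.

(** The lowest [E] digits of [i] in base [b], read backwards; divided by [b ^ E] this is the van der
    Corput radical inverse cut off after [E] digits. *)
Fixpoint digit_rev (b E i : nat) : nat :=
  match E with
  | O => 0%nat
  | S E' => (i mod b * b ^ E' + digit_rev b E' (i / b))%nat
  end.

Lemma digit_rev_lt b E i : (0 < b)%nat -> (digit_rev b E i < b ^ E)%nat.
Proof.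
  intros Hb. revert i; induction E as [|E IH]; intros i; simpl; [lia|].
  specialize (IH (i / b)%nat). pose proof (Nat.mod_upper_bound i b ltac:(lia)). nia.
Qed.

(** The leading digits of the reversal are the low digits of the index, so the box of relative side
    [1 / b ^ c] that contains the point depends only on [i] modulo [b ^ c]. *)
Lemma digit_rev_prefix b c E i : (0 < b)%nat -> (c <= E)%nat ->
  (digit_rev b E i / b ^ (E - c) = digit_rev b c i)%nat.
Proof.
  intros Hb. revert E i; induction c as [|c IH]; intros E i HE.
  - rewrite Nat.sub_0_r. apply Nat.div_small, digit_rev_lt, Hb.
  - destruct E as [|E]; [lia|]. simpl digit_rev. rewrite Nat.sub_succ.
    rewrite <- (IH E (i / b)%nat) by lia.
    replace (b ^ E)%nat with (b ^ c * b ^ (E - c))%nat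
      by (rewrite <- Nat.pow_add_r; f_equal; lia).
    rewrite Nat.mul_assoc. apply Nat.div_add_l. apply Nat.pow_nonzero. lia.
Qed.

Lemma digit_rev_period b c i : (0 < b)%nat -> digit_rev b c (i + b ^ c) = digit_rev b c i.
Proof.
  intros Hb. revert i; induction c as [|c IH]; intros i; [reflexivity|].
  simpl. rewrite (Nat.mul_comm b), Nat.Div0.mod_add, Nat.div_add, IH by lia. reflexivity.
Qed.

Lemma lsum_digit_rev b c a : (0 < b)%nat -> (a < b ^ c)%nat ->
  lsum (seq 0 (b ^ c)) (fun r => indic (digit_rev b c r =? a)%nat) = 1.
Proof.
  intros Hb. revert a; induction c as [|c IH]; intros a Ha.
  - simpl in *. replace a with 0%nat by lia. simpl. lra.
  - assert (Hp : (b ^ c <> 0)%nat) by (apply Nat.pow_nonzero; lia).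
    simpl Nat.pow. rewrite lsum_seq_mul.
    (* The lowest digit [t] of the index must be the leading digit of [a]; the remaining digits are
       governed by the induction hypothesis at [a mod b ^ c]. *)
    rewrite (lsum_ext_in _ _ (fun t => indic (t =? a / b ^ c)%nat)).
    + rewrite lsum_indic_eqb. unfold indic.
      destruct (Nat.ltb_spec (a / b ^ c) b) as [_|H]; [reflexivity|].
      exfalso. apply (Nat.lt_irrefl b). eapply Nat.le_lt_trans; [exact H|].
      apply Nat.Div0.div_lt_upper_bound. simpl in Ha. rewrite Nat.mul_comm. exact Ha.
    + intros t Ht%in_seq.
      rewrite <- (Rmult_1_r (indic _)), <- (IH (a mod b ^ c)) by (apply Nat.mod_upper_bound, Hp).
      rewrite <- lsum_scal. apply lsum_ext; intros u. rewrite <- indic_andb. f_equal.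
      cbn [digit_rev]. rewrite (Nat.mul_comm b u), Nat.Div0.mod_add, Nat.div_add by lia.
      rewrite Nat.mod_small, (Nat.div_small t b), Nat.add_0_l by lia.
      pose proof (digit_rev_lt b c u Hb) as Hlt.
      apply Bool.eq_iff_eq_true. rewrite Bool.andb_true_iff, !Nat.eqb_eq. split.
      * intros <-. split.
        -- rewrite Nat.div_add_l, Nat.div_small by assumption. lia.
        -- rewrite Nat.add_comm, Nat.Div0.mod_add. symmetry; apply Nat.mod_small, Hlt.
      * intros [-> ->]. rewrite (Nat.div_mod_eq a (b ^ c)) at 3. lia.
Qed.

(** * Nodes and the boxes between them *)

Lemma node_le N i k : (0 < N)%nat -> (i <= k)%nat -> node N i <= node N k.
Proof.
  intros HN H. unfold node, Rdiv.
  apply Rmult_le_compat_r; [left; apply Rinv_0_lt_compat, lt_0_INR, HN|].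
  apply Rmult_le_compat_l; [pose proof PI_RGT_0; lra|apply le_INR, H].
Qed.

Lemma node_lt_inv N i k : (0 < N)%nat -> node N i < node N k -> (i < k)%nat.
Proof.
  intros HN H. destruct (le_lt_dec k i) as [Hk|Hk]; [|exact Hk].
  pose proof (node_le N k i HN Hk). lra.
Qed.

Lemma node_lt N i k : (0 < N)%nat -> (i < k)%nat -> node N i < node N k.
Proof.
  intros HN H. unfold node, Rdiv.
  apply Rmult_lt_compat_r; [apply Rinv_0_lt_compat, lt_0_INR, HN|].
  apply Rmult_lt_compat_l; [pose proof PI_RGT_0; lra|apply lt_INR, H].
Qed.

Lemma node_0 N : node N 0 = 0.
Proof. unfold node; simpl; unfold Rdiv; ring. Qed.

Lemma node_full N : (0 < N)%nat -> node N N = 2 * PI.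
Proof. intros HN. unfold node. field. apply not_0_INR. lia. Qed.

Lemma node_mul P L k : (0 < P)%nat -> (0 < L)%nat -> node (P * L) (k * L) = node P k.
Proof.
  intros HP HL. unfold node. rewrite !mult_INR. field.
  split; apply not_0_INR; lia.
Qed.

Lemma node_div P L k : (0 < P)%nat -> (0 < L)%nat ->
  node P (k / L) <= node (P * L) k < node P (S (k / L)).
Proof.
  intros HP HL. rewrite <- (node_mul P L (k / L)), <- (node_mul P L (S (k / L))) by assumption.
  assert (0 < P * L)%nat by (apply Nat.mul_pos_pos; assumption).
  pose proof (Nat.div_mod_eq k L). pose proof (Nat.mod_upper_bound k L ltac:(lia)).
  split; [apply node_le|apply node_lt]; try assumption; nia.
Qed.

Definition boxidx (P : nat) (t : R) : nat := Z.to_nat (Int_part (t * INR P / (2 * PI))).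

Lemma boxidx_spec P t : (0 < P)%nat -> 0 <= t ->
  node P (boxidx P t) <= t < node P (S (boxidx P t)).
Proof.
  intros HP Ht. pose proof PI_RGT_0 as HPI.
  assert (HP' : 0 < INR P) by (apply lt_0_INR, HP).
  set (v := t * INR P / (2 * PI)).
  assert (Hv : 0 <= v).
  { apply Rmult_le_pos; [apply Rmult_le_pos; lra|left; apply Rinv_0_lt_compat; lra]. }
  destruct (base_Int_part v) as [H1 H2].
  assert (H0 : (0 <= Int_part v)%Z).
  { assert (H : (-1 < Int_part v)%Z) by (apply lt_IZR; lra). lia. }
  assert (Hn : INR (boxidx P t) = IZR (Int_part v)).
  { unfold boxidx. fold v. rewrite INR_IZR_INZ, Z2Nat.id by exact H0. reflexivity. }
  unfold node. rewrite S_INR, Hn.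
  replace t with (2 * PI * v / INR P) by (unfold v; field; lra).
  assert (HI : 0 < / INR P) by (apply Rinv_0_lt_compat, HP').
  unfold Rdiv. split.
  - apply Rmult_le_compat_r; [lra|]. apply Rmult_le_compat_l; lra.
  - apply Rmult_lt_compat_r; [lra|]. apply Rmult_lt_compat_l; lra.
Qed.

Lemma boxidx_lt P t : (0 < P)%nat -> 0 <= t < 2 * PI -> (boxidx P t < P)%nat.
Proof.
  intros HP Ht. apply (node_lt_inv P); [exact HP|].
  pose proof (boxidx_spec P t HP ltac:(lra)). rewrite node_full by exact HP. lra.
Qed.

Lemma boxidx_node P L k : (0 < P)%nat -> (0 < L)%nat -> boxidx P (node (P * L) k) = (k / L)%nat.
Proof.
  intros HP HL. pose proof (node_div P L k HP HL) as H1.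
  assert (H0 : 0 <= node (P * L) k).
  { rewrite <- (node_0 (P * L)). apply node_le; [apply Nat.mul_pos_pos; assumption|lia]. }
  pose proof (boxidx_spec P _ HP H0) as H2.
  pose proof (node_lt_inv P (boxidx P (node (P * L) k)) (S (k / L)) HP ltac:(lra)).
  pose proof (node_lt_inv P (k / L) (S (boxidx P (node (P * L) k))) HP ltac:(lra)).
  lia.
Qed.

Lemma in_gridlist d N y : (0 < N)%nat -> In y (gridlist d N) -> in_torus d y.
Proof.
  intros HN. revert y; induction d as [|d IH]; intros y Hy j Hj; [lia|].
  cbn [gridlist] in Hy.
  apply in_flat_map in Hy as (z & Hz & (t & <- & Ht%in_seq)%in_map_iff).
  destruct (Nat.eq_dec j d) as [->|Hjd].
  - rewrite upd_same. rewrite <- (node_0 N), <- (node_full N HN).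
    split; [apply node_le|apply node_lt]; lia.
  - rewrite upd_other by exact Hjd. apply IH; [exact Hz|lia].
Qed.

Lemma lsum_gridlist_rprod d N (g : nat -> R -> R) :
  lsum (gridlist d N) (fun y => rprod d (fun j => g j (y j))) =
  rprod d (fun j => lsum (seq 0 N) (fun k => g j (node N k))).
Proof.
  induction d as [|d IH]; [simpl; lra|].
  cbn [gridlist rprod]. rewrite lsum_flat_map, <- IH, <- lsum_scal_r.
  apply lsum_ext; intros y. rewrite lsum_map, <- lsum_scal.
  apply lsum_ext; intros k. rewrite upd_same. f_equal.
  apply rprod_ext; intros j Hj. rewrite upd_other by lia. reflexivity.
Qed.

Lemma lsum_indic_div L P a : (0 < L)%nat -> (a < P)%nat ->
  lsum (seq 0 (L * P)) (fun k => indic (a =? k / L)%nat) = INR L.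
Proof.
  intros HL Ha. rewrite lsum_seq_mul.
  rewrite (lsum_ext_in _ _ (fun _ => 1)); [rewrite lsum_const, length_seq; ring|].
  intros t Ht%in_seq.
  transitivity (indic (a <? P)%nat).
  - rewrite <- lsum_indic_eqb. apply lsum_ext; intros u.
    rewrite (Nat.mul_comm L u), Nat.div_add, Nat.div_small, Nat.add_0_l, Nat.eqb_sym by lia.
    reflexivity.
  - unfold indic. destruct (Nat.ltb_spec a P); [reflexivity|lia].
Qed.

(** The Halton sequence with radical inverses cut off after [E] digits in every base; box membership
    is read off from the first [c j <= E] digits. *)
Definition halton (E i : nat) : nat -> R :=
  fun j => node (base j ^ E) (digit_rev (base j) E i).

(** Tells whether [y] lies in the box of the [i]-th Halton point. It is periodic in [i] and a
    product over coordinates, and it supplies the coupling [chi]. *)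
Definition box_indic (d : nat) (c : nat -> nat) (i : nat) (y : nat -> R) : R :=
  rprod d (fun j => indic (digit_rev (base j) (c j) i =? boxidx (base j ^ c j) (y j))%nat).

Lemma base_pow_pos j e : (0 < base j ^ e)%nat.
Proof. pose proof (base_ge_2 j). pose proof (Nat.pow_nonzero (base j) e). lia. Qed.

Lemma halton_in_torus d E i : in_torus d (halton E i).
Proof.
  intros j _. unfold halton.
  rewrite <- (node_0 (base j ^ E)), <- (node_full (base j ^ E)) by apply base_pow_pos.
  pose proof (base_ge_2 j).
  split; [apply node_le|apply node_lt]; try apply base_pow_pos; [lia|].
  apply digit_rev_lt. lia.
Qed.

Lemma halton_near d c E i y :
  (forall j, (j < d)%nat -> (c j <= E)%nat) -> in_torus d y -> box_indic d c i y <> 0 ->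
  near d (fun j => node (base j ^ c j) 1) (halton E i) y.
Proof.
  intros Hc Hy H j Hj. set (P := (base j ^ c j)%nat).
  assert (HP : (0 < P)%nat) by apply base_pow_pos.
  assert (Hb : digit_rev (base j) (c j) i = boxidx P (y j)).
  { pose proof (rprod_neq_0 d _ H j Hj) as Hi. cbv beta in Hi. fold P in Hi.
    destruct (Nat.eqb_spec (digit_rev (base j) (c j) i) (boxidx P (y j))); [assumption|].
    exfalso; apply Hi; reflexivity. }
  pose proof (boxidx_spec P (y j) HP ltac:(apply Hy, Hj)) as H1.
  pose proof (node_div P (base j ^ (E - c j)) (digit_rev (base j) E i) HP (base_pow_pos _ _)) as H2.
  rewrite digit_rev_prefix in H2 by (pose proof (base_ge_2 j); auto; lia).
  replace (P * base j ^ (E - c j))%nat with (base j ^ E)%nat in H2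
    by (unfold P; rewrite <- Nat.pow_add_r; f_equal; specialize (Hc j Hj); lia).
  fold (halton E i j) in H2. rewrite Hb in H2.
  assert (HS : forall k, node P (S k) = node P k + node P 1).
  { intros k. unfold node. rewrite S_INR. simpl (INR 1). field. apply not_0_INR; lia. }
  rewrite HS in H1, H2. apply Rabs_le. lra.
Qed.

Lemma box_indic_nonneg d c i y : 0 <= box_indic d c i y.
Proof. apply rprod_nonneg; intros; apply indic_nonneg. Qed.

Lemma box_indic_period d c i y :
  box_indic d c (i + nprod d (fun j => base j ^ c j)%nat) y = box_indic d c i y.
Proof.
  unfold box_indic. apply rprod_ext; intros j Hj. do 2 f_equal.
  destruct (nprod_divide d (fun j => base j ^ c j)%nat j Hj) as [k ->].
  induction k as [|k IH]; [f_equal; lia|].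
  replace (i + S k * base j ^ c j)%nat with (i + k * base j ^ c j + base j ^ c j)%nat by lia.
  rewrite digit_rev_period; [exact IH|]. pose proof (base_ge_2 j); lia.
Qed.

(** Periodicity reduces to the block starting at 0. There each coordinate selects one residue modulo
    [base j ^ c j], and the Chinese remainder theorem combines these into one index. *)
Lemma lsum_box_indic_index d c i y : in_torus d y ->
  lsum (seq 0 (nprod d (fun j => base j ^ c j)%nat)) (fun r => box_indic d c (i + r) y) = 1.
Proof.
  intros Hy. set (P := nprod d (fun j => base j ^ c j)%nat).
  assert (HP : (0 < P)%nat) by (apply nprod_pos; intros; apply base_pow_pos).
  rewrite (lsum_ext _ _ (fun r => box_indic d c (i + 1 * r) y))
    by (intros r; now rewrite Nat.mul_1_l).
  rewrite (lsum_periodic_affine 1 P i (fun r => box_indic d c r y) HP);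
    [|reflexivity|intros l; apply box_indic_period].
  unfold P; clear P HP i.
  induction d as [|d IH]; [unfold box_indic; simpl; lra|].
  pose proof (base_ge_2 d) as Hb.
  etransitivity; [apply (lsum_coprime_mul (nprod d (fun j => base j ^ c j)%nat) (base d ^ c d)
    (fun r => box_indic d c r y)
    (fun r => indic (digit_rev (base d) (c d) r =? boxidx (base d ^ c d) (y d))%nat))|].
  - apply nprod_pos; intros; apply base_pow_pos.
  - apply base_pow_pos.
  - apply nprod_base_coprime; lia.
  - intros l. apply box_indic_period.
  - intros l. rewrite digit_rev_period by lia. reflexivity.
  - rewrite IH by (intros j Hj; apply Hy; lia).
    rewrite lsum_digit_rev; [ring|lia|].
    apply boxidx_lt; [apply base_pow_pos|apply Hy; lia].
Qed.

(** When the side counts divide [N], every box holds the same number of grid points, a product of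
    [N / P_j] over the coordinates. *)
Lemma lsum_box_indic_grid d c i N :
  (0 < N)%nat -> (forall j, (j < d)%nat -> Nat.divide (base j ^ c j) N) ->
  lsum (gridlist d N) (box_indic d c i) * INR (nprod d (fun j => base j ^ c j)%nat) = INR N ^ d.
Proof.
  intros HN Hdiv. unfold box_indic.
  rewrite (lsum_gridlist_rprod d N
    (fun j t => indic (digit_rev (base j) (c j) i =? boxidx (base j ^ c j) t)%nat)).
  induction d as [|d IH]; [simpl; ring|]. cbn [rprod nprod pow].
  rewrite mult_INR, <- IH by (intros j Hj; apply Hdiv; lia).
  destruct (Hdiv d ltac:(lia)) as [L HL].
  assert (HP := base_pow_pos d (c d)). set (P := (base d ^ c d)%nat) in *.
  assert (HL0 : (0 < L)%nat) by (destruct L; lia).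
  replace (lsum (seq 0 N) _) with (INR L).
  - replace (INR N) with (INR L * INR P) by (rewrite <- mult_INR; f_equal; lia). ring.
  - rewrite HL. rewrite <- (lsum_indic_div L P (digit_rev (base d) (c d) i) HL0).
    + apply lsum_ext; intros k. rewrite (Nat.mul_comm L P), boxidx_node by assumption. reflexivity.
    + apply digit_rev_lt. pose proof (base_ge_2 d); lia.
Qed.

(** * Universal discretization *)

(** Stated as a [sig] type so that the exponents can be collected into a function of [j] without a
    choice principle. *)
Lemma pow_bracket b x : (2 <= b)%nat -> (1 <= x)%nat -> {c | (x <= b ^ c <= b * x)%nat}.
Proof.
  intros Hb. induction x as [|x IH]; intros Hx; [lia|].
  destruct (Nat.eq_dec x 0) as [->|Hx0]; [exists 0%nat; simpl; lia|].
  destruct IH as [c Hc]; [lia|].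
  destruct (le_lt_dec (S x) (b ^ c)) as [H|H].
  - exists c. nia.
  - exists (S c). simpl. nia.
Qed.

Lemma nprod_scale d K (s : nat -> nat) :
  (nprod d (fun j => base j * (K * 2 ^ s j)) = K ^ d * nprod d base * 2 ^ norm1 d s)%nat.
Proof.
  induction d as [|d IH]; [reflexivity|]. cbn [nprod].
  replace (norm1 (S d) s) with (norm1 d s + s d)%nat.
  - rewrite IH, Nat.pow_add_r, Nat.pow_succ_r'. ring.
  - unfold norm1. rewrite seq_S, map_app. symmetry.
    transitivity (list_sum (map s (seq 0 d)) + list_sum (map s (0 + d :: nil)))%nat.
    + apply list_sum_app.
    + simpl. rewrite Nat.add_0_r. reflexivity.
Qed.

Definition halton_size (d n : nat) : nat := ((64 * d) ^ d * nprod d base * 2 ^ n)%nat.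

Lemma halton_scale d s : (1 <= d)%nat -> exists c : nat -> nat,
  (forall j, (j < d)%nat -> (64 * d * 2 ^ s j <= base j ^ c j)%nat) /\
  (forall j, (j < d)%nat -> (c j <= halton_size d (norm1 d s))%nat) /\
  (nprod d (fun j => base j ^ c j) <= halton_size d (norm1 d s))%nat.
Proof.
  intros Hd.
  assert (H1 : forall j, (1 <= 64 * d * 2 ^ s j)%nat).
  { intros j. pose proof (Nat.pow_nonzero 2 (s j)). nia. }
  pose (c := fun j => proj1_sig (pow_bracket (base j) (64 * d * 2 ^ s j) (base_ge_2 j) (H1 j))).
  assert (Hc : forall j, (64 * d * 2 ^ s j <= base j ^ c j <= base j * (64 * d * 2 ^ s j))%nat).
  { intros j. unfold c.
    exact (proj2_sig (pow_bracket (base j) (64 * d * 2 ^ s j) (base_ge_2 j) (H1 j))). }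
  assert (Hle : (nprod d (fun j => base j ^ c j) <= halton_size d (norm1 d s))%nat).
  { unfold halton_size. rewrite <- nprod_scale. apply nprod_le. intros j _. apply Hc. }
  exists c. split; [|split].
  - intros j _. apply Hc.
  (* Each [c j] is below its own power, hence below the number of points; so [E = m] digits serve
     every [s] at once. *)
  - intros j Hj. eapply Nat.le_trans; [|exact Hle].
    eapply Nat.le_trans; [apply Nat.lt_le_incl, (Nat.pow_gt_lin_r (base j)), base_ge_2|].
    apply Nat.divide_pos_le.
    + apply nprod_pos; intros; apply base_pow_pos.
    + apply (nprod_divide d (fun j => base j ^ c j)%nat j Hj).
  - exact Hle.
Qed.

(** Source of the constant 64: each coordinate contributes at most [4 * PI / (64 * d)], which is at
    most [1 / (4 * d)] because [PI <= 4]. *)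
Lemma box_weight d (s c : nat -> nat) : (1 <= d)%nat ->
  (forall j, (j < d)%nat -> (64 * d * 2 ^ s j <= base j ^ c j)%nat) ->
  lsum (seq 0 d) (fun j => node (base j ^ c j) 1 * (2 * 2 ^ s j)) <= / 4.
Proof.
  intros Hd Hc. assert (Hd' : 0 < INR d) by (apply lt_0_INR; lia).
  apply Rle_trans with (lsum (seq 0 d) (fun _ => / (4 * INR d))).
  - apply lsum_le; intros j Hj%in_seq. specialize (Hc j ltac:(lia)).
    assert (HP : 0 < INR (base j ^ c j)) by (apply lt_0_INR, base_pow_pos).
    apply le_INR in Hc. rewrite !mult_INR, (pow_INR 2) in Hc.
    replace (INR 64) with 64 in Hc by (simpl; ring).
    replace (INR 2) with 2 in Hc by (simpl; ring).
    unfold node. simpl (INR 1).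
    set (P := INR (base j ^ c j)) in *. set (t := 2 ^ s j) in *.
    assert (Ht : 0 < t) by (apply pow_lt; lra).
    apply Rmult_le_reg_r with (P * (4 * INR d)); [nra|].
    replace (/ (4 * INR d) * (P * (4 * INR d))) with P by (field; lra).
    replace (2 * PI * 1 / P * (2 * t) * (P * (4 * INR d))) with (16 * PI * INR d * t)
      by (field; lra).
    pose proof PI_4. assert (0 < INR d * t) by (apply Rmult_lt_0_compat; assumption). nra.
  - rewrite lsum_const, length_seq. right. field. lra.
Qed.

Lemma node_1_nonneg P : (0 < P)%nat -> 0 <= node P 1.
Proof. intros HP. rewrite <- (node_0 P). apply node_le; [exact HP|lia]. Qed.

Lemma halton_block_compare d s a b c E q i N :
  (1 <= d)%nat -> 1 <= q -> (0 < N)%nat ->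
  (forall j, (j < d)%nat -> (64 * d * 2 ^ s j <= base j ^ c j)%nat) ->
  (forall j, (j < d)%nat -> (c j <= E)%nat) ->
  (forall j, (j < d)%nat -> Nat.divide (base j ^ c j) N) ->
  let P := nprod d (fun j => base j ^ c j)%nat in
  let X := lsum (seq 0 P) (fun r => rpow (tp_abs d s a b (halton E (i + r))) q) in
  let F := grid_sum d N (fun x => rpow (tp_abs d s a b x) q) / INR N ^ d in
  X / INR P <= rpow 2 q * F /\ F <= rpow 2 q * (X / INR P).
Proof.
  intros Hd Hq HN Hc HE Hdiv P X F.
  assert (HP : 0 < INR P) by (apply lt_0_INR, nprod_pos; intros; apply base_pow_pos).
  assert (HNd : 0 < INR N ^ d) by (apply pow_lt, lt_0_INR, HN).
  destruct (tp_grid_compare d s a b N (fun j => node (base j ^ c j) 1) q (seq 0 P)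
    (fun r => halton E (i + r)) (fun r => box_indic d c (i + r)) (INR N ^ d / INR P)) as [H1 H2].
  - exact Hq.
  - intros j Hj. specialize (Hc j Hj). specialize (Hdiv j Hj).
    apply Nat.divide_pos_le in Hdiv; [nia|exact HN].
  - intros j _. apply node_1_nonneg, base_pow_pos.
  - apply box_weight; assumption.
  - intros; apply box_indic_nonneg.
  - intros r y _ Hy Hr. apply halton_near; [exact HE|apply (in_gridlist d N y HN Hy)|exact Hr].
  - intros y Hy. apply lsum_box_indic_index, (in_gridlist d N y HN Hy).
  - intros r _. rewrite <- (lsum_box_indic_grid d c (i + r) N HN Hdiv). fold P. field. lra.
  - rewrite <- grid_sum_lsum in H1, H2 by lia. fold X in H1, H2.
    replace (grid_sum d N _) with (F * INR N ^ d) in H1, H2 by (unfold F; field; lra).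
    split; apply Rmult_le_reg_r with (INR N ^ d); try assumption.
    + replace (X / INR P * INR N ^ d) with (INR N ^ d / INR P * X) by (field; lra). lra.
    + replace (rpow 2 q * (X / INR P) * INR N ^ d)
        with (rpow 2 q * (INR N ^ d / INR P * X)) by (field; lra). lra.
Qed.

(** A bound along arbitrarily late indices suffices, since the comparison is available only for grid
    sizes divisible by the side counts. *)
Lemma Un_cv_le_frequently u I B :
  Un_cv u I -> (forall L, exists n, (L <= n)%nat /\ u n <= B) -> I <= B.
Proof.
  intros Hu H. apply Rnot_lt_le. intros HI.
  destruct (Hu (I - B) ltac:(lra)) as [n0 Hn0]. destruct (H n0) as (n & Hn & Hle).
  specialize (Hn0 n Hn). unfold Rdist in Hn0. apply Rabs_def2 in Hn0. lra.
Qed.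

Lemma Un_cv_ge_frequently u I B :
  Un_cv u I -> (forall L, exists n, (L <= n)%nat /\ B <= u n) -> B <= I.
Proof.
  intros Hu H. apply Rnot_lt_le. intros HI.
  destruct (Hu (B - I) ltac:(lra)) as [n0 Hn0]. destruct (H n0) as (n & Hn & Hle).
  specialize (Hn0 n Hn). unfold Rdist in Hn0. apply Rabs_def2 in Hn0. lra.
Qed.

Lemma halton_block_mean d s a b c E q i I :
  (1 <= d)%nat -> 1 <= q ->
  (forall j, (j < d)%nat -> (64 * d * 2 ^ s j <= base j ^ c j)%nat) ->
  (forall j, (j < d)%nat -> (c j <= E)%nat) ->
  torus_mean d (fun x => rpow (tp_abs d s a b x) q) I ->
  let P := nprod d (fun j => base j ^ c j)%nat in
  let X := lsum (seq 0 P) (fun r => rpow (tp_abs d s a b (halton E (i + r))) q) in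
  X <= rpow 2 q * I * INR P /\ I * INR P <= rpow 2 q * X.
Proof.
  intros Hd Hq Hc HE HI P X.
  assert (HP0 : (0 < P)%nat) by (apply nprod_pos; intros; apply base_pow_pos).
  assert (HP : 0 < INR P) by (apply lt_0_INR, HP0).
  pose proof (rpow_2_ge q Hq) as HK.
  pose (u := fun N => grid_sum d (S N) (fun x => rpow (tp_abs d s a b x) q) / INR (S N) ^ d).
  change (Un_cv u I) in HI.
  assert (Hu : forall L, exists n, (L <= n)%nat /\
    X / INR P <= rpow 2 q * u n /\ u n <= rpow 2 q * (X / INR P)).
  (* The sequence in [torus_mean] is indexed by [N - 1], so this index gives the grid size
     [P * S L], a multiple of every side count. *)
  { intros L. exists (P * S L - 1)%nat. split; [nia|].
    unfold u. replace (S (P * S L - 1)) with (P * S L)%nat by nia.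
    apply (halton_block_compare d s a b c E q i (P * S L)); try assumption; [nia|].
    intros j Hj. apply Nat.divide_mul_l, (nprod_divide d (fun j => base j ^ c j)%nat j Hj). }
  assert (H1 : X / INR P / rpow 2 q <= I).
  { apply (Un_cv_ge_frequently u I _ HI). intros L. destruct (Hu L) as (n & Hn & H & _).
    exists n. split; [exact Hn|]. apply Rmult_le_reg_l with (rpow 2 q); [lra|].
    replace (rpow 2 q * (X / INR P / rpow 2 q)) with (X / INR P) by (field; lra). exact H. }
  assert (H2 : I <= rpow 2 q * (X / INR P)).
  { apply (Un_cv_le_frequently u I _ HI). intros L. destruct (Hu L) as (n & Hn & _ & H).
    exists n. auto. }
  split.
  - apply Rmult_le_compat_r with (r := rpow 2 q * INR P) in H1; [|nra].
    replace (X / INR P / rpow 2 q * (rpow 2 q * INR P)) with X in H1 by (field; lra). lra.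
  - apply Rmult_le_compat_r with (r := INR P) in H2; [|lra].
    replace (rpow 2 q * (X / INR P) * INR P) with (rpow 2 q * X) in H2 by (field; lra). exact H2.
Qed.

(** The [m] points are cut into blocks of length [P]. The incomplete last block is dropped for the
    lower bound and completed for the upper one; since [P <= m], each costs at most a factor 2. *)
Lemma halton_mean d s a b q I :
  (1 <= d)%nat -> 1 <= q ->
  torus_mean d (fun x => rpow (tp_abs d s a b x) q) I ->
  let m := halton_size d (norm1 d s) in
  let D := / INR m * lsum (seq 0 m) (fun i => rpow (tp_abs d s a b (halton m i)) q) in
  / (2 * rpow 2 q) * I <= D /\ D <= 2 * rpow 2 q * I.
Proof.
  intros Hd Hq HI m D.
  destruct (halton_scale d s Hd) as (c & Hc & HE & Hm). fold m in HE, Hm.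
  set (P := nprod d (fun j => base j ^ c j)%nat) in *.
  assert (HP0 : (0 < P)%nat) by (apply nprod_pos; intros; apply base_pow_pos).
  assert (HP : 0 < INR P) by (apply lt_0_INR, HP0).
  assert (Hm' : 0 < INR m) by (apply lt_0_INR; lia).
  set (K := rpow 2 q). assert (HK : 2 <= K) by apply rpow_2_ge, Hq.
  set (g := fun i => rpow (tp_abs d s a b (halton m i)) q) in *.
  assert (Hg : forall i, 0 <= g i) by (intros; apply rpow_nonneg).
  set (X := fun i => lsum (seq 0 P) (fun r => g (i + r)%nat)).
  assert (HX : forall i, X i <= K * I * INR P /\ I * INR P <= K * X i).
  { intros i. apply (halton_block_mean d s a b c m q i I); assumption. }
  (* Nonnegativity of the limit follows from the block estimate itself. *)
  assert (HI0 : 0 <= I).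
  { destruct (HX 0%nat) as [H _].
    assert (0 <= X 0%nat) by (apply lsum_nonneg; intros; apply Hg).
    apply Rmult_le_reg_l with (K * INR P); [apply Rmult_lt_0_compat|]; lra. }
  assert (Hblocks : forall L, lsum (seq 0 (P * L)) g = lsum (seq 0 L) (fun l => X (P * l)%nat)).
  { intros L. rewrite lsum_seq_mul, lsum_swap. apply lsum_ext; intros l.
    apply lsum_ext; intros r. f_equal. lia. }
  set (L := (m / P)%nat).
  pose proof (Nat.div_mod_eq m P) as Hdm. fold L in Hdm.
  pose proof (Nat.mod_upper_bound m P ltac:(lia)) as Hmod.
  assert (HL : (1 <= L)%nat) by (apply Nat.div_le_lower_bound; lia).
  set (Sg := lsum (seq 0 m) g) in *.
  assert (Hlo : INR L * (I * INR P) <= K * Sg).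
  { apply Rle_trans with (K * lsum (seq 0 (P * L)) g).
    - replace (INR L * (I * INR P)) with (lsum (seq 0 L) (fun _ => I * INR P))
        by (rewrite lsum_const, length_seq; reflexivity).
      rewrite Hblocks, <- lsum_scal.
      apply lsum_le; intros l _. apply HX.
    - apply Rmult_le_compat_l; [lra|]. apply lsum_seq_le; [exact Hg|lia]. }
  assert (Hhi : Sg <= INR (S L) * (K * I * INR P)).
  { apply Rle_trans with (lsum (seq 0 (P * S L)) g).
    - apply lsum_seq_le; [exact Hg|nia].
    - replace (INR (S L) * (K * I * INR P)) with (lsum (seq 0 (S L)) (fun _ => K * I * INR P))
        by (rewrite lsum_const, length_seq; reflexivity).
      rewrite Hblocks.
      apply lsum_le; intros l _. apply HX. }
  assert (HmL : INR m <= 2 * (INR L * INR P)).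
  { rewrite <- mult_INR. replace 2 with (INR 2) by (simpl; ring).
    rewrite <- mult_INR. apply le_INR. nia. }
  assert (HmS : INR (S L) * INR P <= 2 * INR m).
  { rewrite <- mult_INR. replace 2 with (INR 2) by (simpl; ring).
    rewrite <- mult_INR. apply le_INR. nia. }
  split.
  - apply Rmult_le_reg_l with (2 * K * INR m); [nra|].
    replace (2 * K * INR m * (/ (2 * K) * I)) with (INR m * I) by (field; lra).
    replace (2 * K * INR m * D) with (2 * (K * Sg)) by (unfold D; field; lra). nra.
  - apply Rmult_le_reg_l with (INR m); [lra|].
    replace (INR m * D) with Sg by (unfold D; field; lra).
    assert (0 <= K * I) by nra. nra.
Qed.

(** With [M] the global supremum, every value of |f| is within [M / 4] of one at a Halton point of
    the first block, so [M <= D + M / 4], which is more than the factor 1/2 requires. *)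
Lemma halton_max d s a b x :
  (1 <= d)%nat ->
  let m := halton_size d (norm1 d s) in
  let D := fold_right Rmax 0 (map (tp_abs d s a b) (map (halton m) (seq 0 m))) in
  / 2 * tp_abs d s a b x <= D.
Proof.
  intros Hd m D.
  destruct (halton_scale d s Hd) as (c & Hc & HE & Hm). fold m in HE, Hm.
  set (P := nprod d (fun j => base j ^ c j)%nat) in *.
  assert (HP0 : (0 < P)%nat) by (apply nprod_pos; intros; apply base_pow_pos).
  assert (HD : forall i, (i < P)%nat -> tp_abs d s a b (halton m i) <= D).
  { intros i Hi.
    assert (Hin : In (halton m i) (map (halton m) (seq 0 m))).
    { apply in_map, in_seq. lia. }
    unfold D. induction (map (halton m) (seq 0 m)) as [|z l IH]; [destruct Hin|].
    simpl. destruct Hin as [->|Hin]; [apply Rmax_l|].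
    eapply Rle_trans; [exact (IH Hin)|apply Rmax_r]. }
  pose (E := fun v => exists x, v = tp_abs d s a b x).
  assert (Hb : bound E).
  { destruct (tp_abs_bounded d s a b) as [B HB]. exists B. intros v (z & ->). apply HB. }
  destruct (completeness E Hb (ex_intro _ _ (ex_intro _ x eq_refl))) as [M [HM1 HM2]].
  assert (HM : forall z, tp_abs d s a b z <= M) by (intros z; apply HM1; exists z; reflexivity).
  assert (HM0 : 0 <= M) by (eapply Rle_trans; [apply tp_abs_nonneg|apply (HM x)]).
  set (delta := fun j => node (base j ^ c j) 1).
  assert (Hdelta : forall j, (j < d)%nat -> 0 <= delta j)
    by (intros; apply node_1_nonneg, base_pow_pos).
  assert (HP4 : forall j, (j < d)%nat -> (4 * 2 ^ s j <= P)%nat).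
  { intros j Hj. specialize (Hc j Hj).
    pose proof (nprod_divide d (fun j => base j ^ c j)%nat j Hj) as H.
    apply Nat.divide_pos_le in H; [fold P in H; nia|exact HP0]. }
  assert (HMD : M <= D + / 4 * M).
  { apply HM2. intros v (z & ->).
    destruct (tp_abs_torus d s a b z) as (y & Hy & <-).
    (* If no point of the block shared the box of [y], the sum of indicators would be 0 and not
       1. *)
    assert (Hi : exists i, (i < P)%nat /\ box_indic d c i y <> 0).
    { apply NNPP. intros Hn.
      pose proof (lsum_box_indic_index d c 0 y Hy) as H1. fold P in H1.
      rewrite (lsum_ext_in _ _ (fun _ => 0)), lsum_0 in H1; [lra|].
      intros r Hr%in_seq. apply NNPP. intros Hr0. apply Hn. exists r. split; [lia|exact Hr0]. }
    destruct Hi as (i & HiP & Hi).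
    destruct (tp_abs_osc d s a b P delta (fun _ => M) (halton m i) y HP4) as [_ H].
    - intros z' y' _. apply HM.
    - apply halton_near; assumption.
    - specialize (HD i HiP).
      assert (osc_bound d s P delta (fun _ => M) y <= / 4 * M); [|lra].
      unfold osc_bound.
      rewrite (lsum_ext _ _ (fun j => lsum (seq 0 P)
        (fun k => delta j * Rabs (bern (2 ^ s j) P k)) * M)) by (intros; apply lsum_scal_r).
      rewrite lsum_scal_r. apply Rmult_le_compat_r; [exact HM0|].
      eapply Rle_trans; [apply osc_bound_weight; assumption|].
      apply box_weight; assumption. }
  specialize (HM x). pose proof (tp_abs_nonneg d s a b x). lra.
Qed.

Theorem theorem1p1 (d : nat) (hd : (1 <= d)%nat) (q : exponent) (hq : valid_exp q) :
  exists C C1 C2 : R, 0 < C /\ 0 < C1 /\ 0 < C2 /\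
    forall n : nat, exists xi : list (nat -> R),
      (1 <= length xi)%nat /\
      INR (length xi) <= C * 2 ^ n /\
      Forall (in_torus d) xi /\
      univ_disc d q C1 C2 xi n.
Proof.
  (* The factor in front of [2 ^ n] in [halton_size]; it depends on [d] alone. *)
  set (C0 := ((64 * d) ^ d * nprod d base)%nat).
  assert (HC0 : (1 <= C0)%nat).
  { assert ((64 * d) ^ d <> 0)%nat by (apply Nat.pow_nonzero; lia).
    pose proof (nprod_pos d base (fun j _ => Nat.lt_0_succ _)). unfold C0. nia. }
  assert (HC : 0 < INR C0) by (apply lt_0_INR; lia).
  assert (Hnet : forall n, let m := halton_size d n in
    (1 <= length (map (halton m) (seq 0 m)))%nat /\
    INR (length (map (halton m) (seq 0 m))) <= INR C0 * 2 ^ n /\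
    Forall (in_torus d) (map (halton m) (seq 0 m))).
  { intros n m. rewrite length_map, length_seq. unfold m at 1 2, halton_size. fold C0. split; [|split].
    - pose proof (Nat.pow_nonzero 2 n). nia.
    - rewrite mult_INR, pow_INR. right; reflexivity.
    - apply Forall_forall. intros z (i & <- & _)%in_map_iff. apply halton_in_torus. }
  destruct q as [q|]; simpl in hq.
  - pose proof (rpow_2_ge q hq) as HK.
    exists (INR C0), (/ (2 * rpow 2 q)), (2 * rpow 2 q).
    split; [exact HC|]. split; [apply Rinv_0_lt_compat; lra|]. split; [lra|].
    intros n. exists (map (halton (halton_size d n)) (seq 0 (halton_size d n))).
    destruct (Hnet n) as (H1 & H2 & H3). repeat (split; [assumption|]).
    intros s a b <- I HI. rewrite length_map, length_seq, fold_Rplus_lsum, lsum_map.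
    apply halton_mean; assumption.
  - exists (INR C0), (/ 2), 1. split; [exact HC|]. split; [lra|]. split; [lra|].
    intros n. exists (map (halton (halton_size d n)) (seq 0 (halton_size d n))).
    destruct (Hnet n) as (H1 & H2 & H3). repeat (split; [assumption|]).
    intros s a b <-. split.
    + intros x _. apply halton_max; assumption.
    + intros B HB.
      (* The folded maximum starts from 0, so [B] must be shown nonnegative; any torus point gives
         this. *)
      assert (HB0 : 0 <= B).
      { eapply Rle_trans; [apply tp_abs_nonneg|apply (HB (halton 0 0)), halton_in_torus]. }
      clear H1 H2. induction H3 as [|z l Hz _ IH]; simpl; [exact HB0|].
      apply Rmax_lub; [apply HB, Hz|exact IH].
Qed.
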